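(* Let $N\in\mathbb N$ be a truncation index and $M=\max\{m_1,\dots,m_N\}$. Consider the truncated equation $$\ddot\phi=a_0(\phi,\dot\phi)+\sum_{i=1}^Nh^ia_i(\{\phi\}_{m_i\mathrm{jet}})\qquad(T)$$ and its reduced second-order equation $$\ddot\phi=a_0(\phi,\dot\phi)+\sum_{i=1}^Nh^i\tilde a_i(\phi,\dot\phi).\qquad(R)$$ If $I\colon\mathrm{Jet}_M(Q)\to\mathbb R$ is conserved along solutions of $(T)$ up to $\mathcal O(h^{N+1})$ terms, then $I$ induces a quantity $\overline I\colon\mathrm{Jet}_1(Q)\to\mathbb R$ that is conserved along solutions of the reduced system $(R)$ up to $\mathcal O(h^{N+1})$ terms. If $\gamma$ is a solution of $(R)$ and $\mathrm{jet}_M(\gamma)$ is its prolongation, then $\overline I\circ\gamma=I\circ\mathrm{jet}_M(\gamma)+\mathcal O(h^{N+1})$.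
   Context: Everything is local and formal in $h$; maps are sufficiently regular. $Q$ is an $n$-dimensional manifold locally identified with an open subset of $\mathbb R^n$; $\phi$ depends on a 1-dimensional variable $\xi$ with values in $Q$. $\mathrm{Jet}_K(Q)$ is the $K$-jet space over $Q$ with coordinates $\{\phi\}_{K\mathrm{jet}}=(\phi,\dot\phi,\phi^{(2)},\dots,\phi^{(K)})$. The equation $\ddot\phi=a_0(\phi,\dot\phi)+\sum_{i\ge1}h^ia_i(\{\phi\}_{m_i\mathrm{jet}})$ ($a_i$ being $\mathbb R^n$-valued) arises from the Euler--Lagrange equations $\sum_{i\ge0}(-1)^i\frac{\mathrm d^i}{\mathrm d\xi^i}\frac{\partial\mathcal L}{\partial\phi_j^{(i)}}=0$, $j=1,\dots,n$, of a formal power series Lagrangian $\mathcal L=\mathcal L^0(\phi,\dot\phi)+\sum_{i\ge1}h^i\mathcal L^i$, each $\mathcal L^i$ depending on a finite jet of $\phi$, with $\big(\partial^2\mathcal L^0/\partial\dot\phi_i\partial\dot\phi_j\big)_{1\le i,j\le n}$ invertible. $(T)$ is its truncation after order $h^N$. $(R)$ is obtained from $(T)$ by repeatedly substituting derivatives of order $j\ge2$ on the right-hand side by the expression for $\phi^{(j)}$ given by the $(j-2)$-nd derivative of $(T)$, discarding $\mathcal O(h^{N+1})$ terms. In particular, prolonged solutions of $(R)$ satisfy $(T)$ up to $\mathcal O(h^{N+1})$. Conventions: ''conserved along solutions up to $\mathcal O(h^{N+1})$ terms'' means that the $\xi$-derivative of the quantity along (prolongations of) curves satisfying the equation up to $\mathcal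 O(h^{N+1})$ is $\mathcal O(h^{N+1})$. The quantity $\overline I$ may depend on $h$. $\overline I\circ\gamma$ denotes $\overline I$ evaluated along the 1-jet $(\gamma,\dot\gamma)$; $\mathrm{jet}_M(\gamma)=(\gamma,\dot\gamma,\dots,\gamma^{(M)})$. *)

(* Defs.v *)
From HB Require Import structures.
From mathcomp Require Import all_boot all_order all_algebra.
From mathcomp Require Import all_classical all_reals all_analysis.
Set Implicit Arguments.
Unset Strict Implicit.
Unset Printing Implicit Defensive.
Import Order.TTheory GRing.Theory Num.Theory.
Import numFieldNormedType.Exports.

Local Open Scope classical_set_scope.
Local Open Scope ring_scope.

(* C^oo on U: every iterated directional derivative is (Frechet) differentiable
   at every point of U.  Only used with U open. *)
Definition smooth_on (R : realType) (V W : normedModType R) (U : set V)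
    (f : V -> W) : Prop :=
  forall (vs : seq V) (x : V), U x ->
    differentiable (foldr (fun v (g : V -> W) => (fun y => 'D_v g y)) f vs) x.

Section Jets.
Context {R : realType} {n : nat}.
Implicit Types (W : normedModType R) (Q : set 'rV[R]_n).

(* A point of Jet_K is a matrix with K + 1 rows, row j being phi^(j). *)
Definition jet_space (K : nat) Q : set 'M[R]_(K.+1, n) :=
  [set p | Q (row ord0 p)].

(* Jets of unspecified order are sequences z, z j being phi^(j); every function
   below depends on finitely many entries. *)
Definition trunc (K : nat) (z : nat -> 'rV[R]_n) : 'M[R]_(K.+1, n) :=
  \matrix_(j < K.+1) z j.

Definition prolong (c : R -> 'rV[R]_n) (x : R) : nat -> 'rV[R]_n :=
  fun j => derive1n j c x.

(* The partial sum, up to and including h^N, of the formal power series whose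
   i-th coefficient is the function f i on the jets of order m i. *)
Definition series_upto W (N : nat) (m : nat -> nat)
    (f : forall i, 'M[R]_((m i).+1, n) -> W) (h : R) (z : nat -> 'rV[R]_n) : W :=
  \sum_(i < N.+1) h ^+ i *: f i (trunc (m i) z).

(* (h, x) |-> g h x is a curve depending smoothly on h near 0; a formal power
   series of curves, truncated at any order, is the polynomial case. *)
Definition family_dom (e al be : R) : set (R * R) :=
  [set p | `|p.1| < e /\ al < p.2 < be].

Definition curve_family Q (e al be : R) (g : R -> R -> 'rV[R]_n) : Prop :=
  [/\ 0 < e,
      smooth_on (family_dom e al be) (fun p : R * R => g p.1 p.2) &
      forall p, family_dom e al be p -> Q (g p.1 p.2)].

(* F h x = O(h^(N+1)) as h -> 0, locally uniformly in x on ]al, be[. *)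
Definition Oh_next W (N : nat) (al be : R) (F : R -> R -> W) : Prop :=
  forall x0 : R, al < x0 < be ->
    (fun p : R * R => F p.1 p.2)
      =O_ (nbhs ((0, x0) : R * R)) (fun p : R * R => p.1 ^+ N.+1 : R).

(* g solves  phi'' = a_0 + h a_1 + ... + h^N a_N  up to O(h^(N+1)). *)
Definition solves (N : nat) (m : nat -> nat)
    (a : forall i, 'M[R]_((m i).+1, n) -> 'rV[R]_n)
    (al be : R) (g : R -> R -> 'rV[R]_n) : Prop :=
  Oh_next N al be (fun h x => derive1n 2 (g h) x - series_upto N a h (prolong (g h) x)).

Definition conserved Q (N : nat) (m : nat -> nat)
    (a : forall i, 'M[R]_((m i).+1, n) -> 'rV[R]_n)
    (k : nat -> nat) (F : forall i, 'M[R]_((k i).+1, n) -> R) : Prop :=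
  forall (e al be : R) (g : R -> R -> 'rV[R]_n),
    curve_family Q e al be g -> solves N a al be g ->
    Oh_next N al be
      (fun h x => derive1 (fun y => series_upto N F h (prolong (g h) y)) x).

(* The direction of the jet coordinate phi_j^(l); it is 0 when l > K. *)
Definition jet_dir (K l : nat) (j : 'I_n) : 'M[R]_(K.+1, n) :=
  \matrix_(r < K.+1, s < n) ((r == l :> nat) && (s == j))%:R.

Definition jet_partial (K l : nat) (j : 'I_n) (f : 'M[R]_(K.+1, n) -> R) :
    'M[R]_(K.+1, n) -> R :=
  fun p => 'D_(jet_dir K l j) f p.

(* The j-th Euler-Lagrange expression of L along the curve c. *)
Definition euler_lagrange (K : nat) (L : 'M[R]_(K.+1, n) -> R)
    (j : 'I_n) (c : R -> 'rV[R]_n) (x : R) : R :=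
  \sum_(l < K.+1)
    (-1) ^+ l * derive1n l (fun y => jet_partial l j L (trunc K (prolong c y))) x.

Definition velocity_hessian (K : nat) (L : 'M[R]_(K.+1, n) -> R)
    (p : 'M[R]_(K.+1, n)) : 'M[R]_n :=
  \matrix_(i, j) jet_partial 1 i (jet_partial 1 j L) p.

(* The series equation phi'' = a_0 + h a_1 + ... and the Euler-Lagrange
   equations of L_0 + h L_1 + ... have the same solutions to every order in h.
   This holds in particular when the a_i are got by solving the Euler-Lagrange
   equations for phi'' with the inverse Hessian of L_0. *)
Definition arises_from Q (m : nat -> nat)
    (a : forall i, 'M[R]_((m i).+1, n) -> 'rV[R]_n)
    (k : nat -> nat) (L : forall i, 'M[R]_((k i).+1, n) -> R) : Prop :=
  forall (K : nat) (e al be : R) (g : R -> R -> 'rV[R]_n),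
    curve_family Q e al be g ->
    (forall j : 'I_n,
       Oh_next K al be
         (fun h x => \sum_(i < K.+1) h ^+ i * euler_lagrange (L i) j (g h) x))
    <-> solves K a al be g.

(* d/dxi on functions of the jet: the derivative at z in the direction
   (z 1, z 2, ...). *)
Definition total_deriv W (f : (nat -> 'rV[R]_n) -> W) :
    (nat -> 'rV[R]_n) -> W :=
  fun z => derive1 (fun t : R => f (fun j => z j + t *: z j.+1)) 0.

(* phi and phi' are kept; phi^(j), j >= 2, becomes the (j-2)-nd derivative of
   the right-hand side of the equation truncated after h^N. *)
Definition substitute (N : nat) (m : nat -> nat)
    (a : forall i, 'M[R]_((m i).+1, n) -> 'rV[R]_n) (h : R)
    (z : nat -> 'rV[R]_n) : nat -> 'rV[R]_n :=
  fun j => if (j < 2)%N then z j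
           else iter (j - 2) (@total_deriv 'rV[R]_n) (series_upto N a h) z.

(* One round of substitutions in c_0 + h c_1 + ... + h^N c_N; the result is
   given by its Taylor coefficients at h = 0, those beyond h^N being discarded
   (only c i with i <= N is ever read). *)
Definition substitution_step (N : nat) (m : nat -> nat)
    (a : forall i, 'M[R]_((m i).+1, n) -> 'rV[R]_n)
    (c : nat -> (nat -> 'rV[R]_n) -> 'rV[R]_n) :
    nat -> (nat -> 'rV[R]_n) -> 'rV[R]_n :=
  fun i z => (i`!%:R)^-1 *:
    derive1n i
      (fun h : R => \sum_(k < N.+1) h ^+ k *: c k (substitute N a h z)) 0.

(* After finitely many rounds the coefficients up to h^N only depend on the
   1-jet, and are then a_tilde 0, ..., a_tilde N.  In particular a_tilde 0 = a 0 as soon as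
   a 0 is a function of the 1-jet. *)
Definition reduces_to Q (N : nat) (m : nat -> nat)
    (a : forall i, 'M[R]_((m i).+1, n) -> 'rV[R]_n)
    (a_tilde : nat -> 'M[R]_(2, n) -> 'rV[R]_n) : Prop :=
  exists s : nat, forall (i : nat) (z : nat -> 'rV[R]_n), (i <= N)%N -> Q (z 0%N) ->
    iter s (substitution_step N a) (fun k y => a k (trunc (m k) y)) i z
    = a_tilde i (trunc 1 z).

End Jets.

Arguments jet_space {R n} K Q _.

(* Main.v *)
(* The proof needs no existence theory for ODEs.  Write F for the right-hand side of (T) and S for
   the substitution of phi^(j), j >= 2, by the (j-2)-nd derivative of F, acting on jets.  After s
   rounds the right-hand side of (R) is F o S^s up to O(h^(N+1)).  Let z be the prolongation of a
   solution of (R).  If z_2 = F(z) + O(h^r), then differentiating in xi gives S z = z + O(h^r),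
   hence S^s z = z + O(h^r); as F sees derivatives of order >= 2 only with a factor h, this gives
   z_2 = F(S^s z) = F(z) + O(h^(r+1)).  By induction on r, z solves (T) up to O(h^(N+1)), so I is
   conserved along it.  Finally (R) expresses all z_j through the 1-jet; inserting this in I and
   keeping the Taylor coefficients in h gives Ibar, which differs from I along z by a smooth
   O(h^(N+1)), whose xi-derivative is again O(h^(N+1)). *)
Require Import Defs.
From HB Require Import structures.
From mathcomp Require Import all_boot all_order all_algebra.
From mathcomp Require Import all_classical all_reals all_analysis.
From mathcomp Require Import lra.
Import Order.TTheory GRing.Theory Num.Theory.
Import numFieldNormedType.Exports.
Local Open Scope classical_set_scope.
Local Open Scope ring_scope.

Set Implicit Arguments.
Unset Strict Implicit.
Unset Printing Implicit Defensive.

(** * Smooth maps between finite-dimensional spaces *)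

Section ContinuousLinear.
Context {R : realType}.
Implicit Types V W : normedModType R.

(** The delicate point is the differentiation in xi, since an O(h^r) bound does not pass to
    derivatives in general. It does here because the families are jointly smooth in h and x and the
    bound holds at every x of an interval: the Taylor coefficients in h of the xi-derivative must
    then vanish below order r, and only a Taylor remainder is left. A second obstacle is that a
    substituted jet S z is in general no longer the prolongation of a curve, so that total
    derivatives on it are not xi-derivatives. Hence differentiation in xi is applied to z only. The
    later rounds S^s z are treated as arbitrary smooth families of jets, and local Lipschitz bounds
    carry the order in h through the smooth maps acting on them. *)

Definition clinear V W (L : V -> W) : Prop := linear L /\ continuous L.

Lemma clinear_bundle V W (L : V -> W) : clinear L ->
  exists2 f : {linear V -> W}, L = f & continuous f.
Proof.
move=> [Ll Lc]; pose m := GRing.isLinear.Build _ _ _ _ _ Ll.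
pose f : {linear _ -> _} := HB.pack L m.
by exists f.
Qed.

Lemma clinear_comp (U V W : normedModType R) (f : V -> W) (g : U -> V) :
  clinear f -> clinear g -> clinear (f \o g).
Proof.
move=> [fl fc] [gl gc]; split=> [a u v|x /=]; first by rewrite /= gl fl.
by apply: continuous_comp; [exact: gc|exact: fc].
Qed.

Lemma clinear_id V : clinear (@id V).
Proof. by split=> // x; exact: cvg_id. Qed.

Lemma clinear_fst V W : clinear (@fst V W).
Proof. by split=> // x; exact: cvg_fst. Qed.

Lemma clinear_snd V W : clinear (@snd V W).
Proof. by split=> // x; exact: cvg_snd. Qed.

Lemma clinear_scalel V (w : V) : clinear (fun k : R => k *: w).
Proof.
split=> [a u v|]; last exact: scalel_continuous.
by rewrite scalerDl -scalerA.
Qed.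

Lemma clinear_coord m n i j : clinear (fun M : 'M[R]_(m, n) => M i j : R).
Proof. by split; [move=> a u v; rewrite !mxE|exact: coord_continuous]. Qed.

Lemma clinearB V W (L : V -> W) u v : clinear L -> L (u - v) = L u - L v.
Proof. by move=> /clinear_bundle[f -> _]; rewrite linearB. Qed.

Lemma clinearZ V W (L : V -> W) a v : clinear L -> L (a *: v) = a *: L v.
Proof. by move=> /clinear_bundle[f -> _]; rewrite linearZ. Qed.

Lemma clinear_sum V W (L : V -> W) (I : Type) (r : seq I) P (F : I -> V) : clinear L ->
  L (\sum_(i <- r | P i) F i) = \sum_(i <- r | P i) L (F i).
Proof. by move=> /clinear_bundle[f -> _]; rewrite linear_sum. Qed.

Lemma clinear_differentiable V W (L : V -> W) x : clinear L -> differentiable L x.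
Proof. by move=> /clinear_bundle[f -> fc]; exact: linear_differentiable. Qed.

Lemma clinear_derive V W (L : V -> W) x v : clinear L -> 'D_v L x = L v.
Proof.
move=> L_; rewrite deriveE; last exact: clinear_differentiable.
by move: L_ => /clinear_bundle[f -> fc]; rewrite diff_lin.
Qed.

Lemma clinear_bound V W (L : V -> W) : clinear L ->
  exists2 k : R, 0 < k & forall x, `|L x| <= k * `|x|.
Proof. by move=> /clinear_bundle[f -> fc]; exact: linear_lipschitz. Qed.

(** This serves the chain rule: [smooth_on] differentiates along fixed directions, while the
    derivative of a composite runs along a direction that moves with the point. Expanding that
    direction along the fixed [b i] returns to derivatives of the first kind. *)
Definition finite_dim V : Prop :=
  exists (I : finType) (b : I -> V) (c : I -> V -> R),
    (forall i, clinear (c i)) /\ forall v, v = \sum_i c i v *: b i.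

Lemma finite_dim_R : finite_dim R.
Proof.
exists unit, (fun=> 1), (fun=> id); split=> [_|v]; first exact: clinear_id.
by rewrite (bigD1 tt) //= big1 ?addr0; [rewrite [_ *: _]mulr1|case].
Qed.

Lemma finite_dim_prod V W : finite_dim V -> finite_dim W -> finite_dim (V * W)%type.
Proof.
move=> [I [b [c [cc cE]]]] [J [b' [c' [cc' cE']]]].
exists (I + J)%type, (fun s => match s with inl i => (b i, 0) | inr j => (0, b' j) end),
  (fun s => match s with inl i => c i \o fst | inr j => c' j \o snd end).
split=> [[i|j]|[v w]] /=.
- by apply: clinear_comp => //; exact: clinear_fst.
- by apply: clinear_comp => //; exact: clinear_snd.
rewrite big_sumType /=.
apply: injective_projections => /=.
  rewrite (clinear_sum _ _ _ (clinear_fst V W)) (clinear_sum _ _ _ (clinear_fst V W)) /=.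
  by rewrite -cE big1 ?addr0// => j _; rewrite scaler0.
rewrite (clinear_sum _ _ _ (clinear_snd V W)) (clinear_sum _ _ _ (clinear_snd V W)) /=.
by rewrite -cE' big1 ?add0r// => j _; rewrite scaler0.
Qed.

Lemma finite_dim_mx m n : finite_dim 'M[R]_(m, n).
Proof.
exists ('I_m * 'I_n)%type, (fun ij => delta_mx ij.1 ij.2),
  (fun ij (M : 'M[R]_(m, n)) => M ij.1 ij.2).
split=> [[i j]|M]; first exact: clinear_coord.
by rewrite {1}[M]matrix_sum_delta pair_bigA.
Qed.

End ContinuousLinear.

Lemma near_eq_differentiable (R : realType) (V W : normedModType R) (f g : V -> W) (x : V) :
  {near x, f =1 g} -> differentiable f x -> differentiable g x.
Proof.
move=> fg /diff_locallyP[cf dfx].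
have fgx : f x = g x by exact: (nbhs_singleton fg).
have dg : g \o shift x = cst (g x) + 'd f x +o_ 0 id.
  apply/eqaddoP => e e0; move/eqaddoP : dfx => /(_ e e0) dfx.
  have fg0 : \forall y \near (0 : V), f (y + x) = g (y + x).
    have cx : (fun y => y + x) @ (0 : V) --> x.
      by rewrite -[X in _ --> X]add0r; apply: cvgD; [exact: cvg_id|exact: cvg_cst].
    exact: (cx _ fg).
  near=> y.
  have -> : (g \o shift x - (cst (g x) + 'd f x)) y = (f \o shift x - (cst (f x) + 'd f x)) y.
    by rewrite !fctE /= -fgx; congr (_ - _); rewrite (near fg0 y).
  by near: y; exact: dfx.
by apply/diff_locallyP; rewrite (diff_unique cf dg).
Unshelve. all: by end_near. Qed.

(** * Closure properties of smooth maps *)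

Section SmoothCalculus.
Context {R : realType}.
Implicit Types V W : normedModType R.

(** A finite order gives something to induct on: the derivative of a product or of a composite still
    contains undifferentiated factors, which [CkW] supplies at the lower order. *)
Fixpoint Ck V W (k : nat) (U : set V) (f : V -> W) : Prop :=
  (forall x, U x -> differentiable f x) /\
  if k is k'.+1 then forall v, Ck k' U (fun y => 'D_v f y) else True.

Lemma Ck_differentiable V W k U (f : V -> W) x : Ck k U f -> U x -> differentiable f x.
Proof. by case: k => [|k] [H _] /H. Qed.

Lemma CkW V W k U (f : V -> W) : Ck k.+1 U f -> Ck k U f.
Proof.
elim: k f => [|k IH] f [fd fD]; first by split.
by split=> // v; apply: IH; exact: fD.
Qed.

Lemma smooth_onP V W U (f : V -> W) : smooth_on U f <-> forall k, Ck k U f.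
Proof.
split=> [sf k|sf vs].
  elim: k f sf => [|k IH] f sf; (split; first by move=> x; exact: (sf [::])) => // v.
  by apply: IH => vs x Ux; have := sf (rcons vs v) x Ux; rewrite foldr_rcons.
elim/last_ind: vs f sf => [|vs v IH] f sf x Ux; first exact: (sf 0%N).1.
by rewrite foldr_rcons; apply: IH => // k; exact: (sf k.+1).2.
Qed.

Lemma smooth_derive V W U (f : V -> W) v : smooth_on U f -> smooth_on U (fun y => 'D_v f y).
Proof. by move=> sf vs x Ux; have := sf (rcons vs v) x Ux; rewrite foldr_rcons. Qed.

Lemma smooth_differentiable V W U (f : V -> W) x : smooth_on U f -> U x -> differentiable f x.
Proof. by move=> sf; exact: (sf [::]). Qed.

Lemma open_near V (U : set V) (P : V -> Prop) x :
  open U -> U x -> (forall y, U y -> P y) -> \forall y \near x, P y.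
Proof. by move=> oU Ux UP; apply: filterS UP _; exact: open_nbhs_nbhs. Qed.

Lemma Ck_ext V W k (U : set V) (f g : V -> W) : open U ->
  (forall x, U x -> f x = g x) -> Ck k U f -> Ck k U g.
Proof.
move=> oU; elim: k f g => [|k IH] f g fg [fd fD]; (split;
  first by (move=> x Ux; apply: near_eq_differentiable (fd _ Ux);
    exact: open_near oU Ux fg)) => // v.
apply: IH (fD v) => x Ux; apply: near_eq_derive.
exact: open_near oU Ux fg.
Qed.

Lemma Ck_cst V W k (U : set V) (w : W) : Ck k U (cst w).
Proof.
elim: k w => [|k IH] w; split=> // v.
have -> : (fun y : V => 'D_v (cst w) y) = cst 0 by apply/funext => y; rewrite derive_cst.
exact: IH.
Qed.

Lemma Ck_clinear V W k (U : set V) (L : V -> W) : clinear L -> Ck k U L.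
Proof.
move=> Ll; case: k => [|k]; (split; first by move=> x _; exact: clinear_differentiable) => // v.
have -> : (fun y : V => 'D_v L y) = cst (L v).
  by apply/funext => y; rewrite clinear_derive.
exact: Ck_cst.
Qed.

Lemma CkD V W k (U : set V) (f g : V -> W) : open U ->
  Ck k U f -> Ck k U g -> Ck k U (fun x => f x + g x).
Proof.
move=> oU; elim: k f g => [|k IH] f g cf cg; (split;
  first by (move=> x Ux; apply: differentiableD; apply: Ck_differentiable Ux; eassumption)) => // v.
apply: Ck_ext (IH _ _ (cf.2 v) (cg.2 v)) => // x Ux.
by rewrite deriveD//; apply: diff_derivable; apply: Ck_differentiable Ux; eassumption.
Qed.

Lemma Ck_sum V W k (U : set V) (I : Type) (r : seq I) (f : I -> V -> W) : open U ->
  (forall i, Ck k U (f i)) -> Ck k U (fun x => \sum_(i <- r) f i x).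
Proof.
move=> oU cf; elim: r => [|i r IH].
  by under eq_fun do rewrite big_nil; exact: Ck_cst.
by under eq_fun do rewrite big_cons; exact: CkD.
Qed.

Lemma derive_clinear_comp V (W W' : normedModType R) (f : V -> W) (L : W -> W') x v :
  clinear L -> differentiable f x -> 'D_v (L \o f) x = L ('D_v f x).
Proof.
move=> Ll df; have dL y := clinear_differentiable y Ll.
rewrite !deriveE//; last exact: differentiable_comp.
by rewrite diff_comp//= -deriveE// clinear_derive.
Qed.

Lemma Ck_clinear_comp V (W W' : normedModType R) k (U : set V) (f : V -> W) (L : W -> W') :
  open U -> clinear L -> Ck k U f -> Ck k U (L \o f).
Proof.
move=> oU Ll; elim: k f => [|k IH] f cf; (split;
  first by (move=> x Ux; apply: differentiable_comp;
    [exact: Ck_differentiable cf Ux|exact: clinear_differentiable])) => // v.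
apply: Ck_ext (IH _ (cf.2 v)) => // x Ux.
by rewrite derive_clinear_comp//; exact: Ck_differentiable cf Ux.
Qed.

Lemma CkM V k (U : set V) (f g : V -> R) : open U ->
  Ck k U f -> Ck k U g -> Ck k U (fun x => f x * g x).
Proof.
move=> oU; elim: k f g => [|k IH] f g cf cg; (split;
  first by (move=> x Ux; apply: differentiableM; apply: Ck_differentiable Ux; eassumption)) => // v.
apply: Ck_ext (CkD oU (IH _ _ (CkW cf) (cg.2 v)) (IH _ _ (CkW cg) (cf.2 v))) => // x Ux.
by rewrite deriveM//; apply: diff_derivable; apply: Ck_differentiable Ux; eassumption.
Qed.

Lemma Ck_coords V W k (U : set V) (f : V -> W) : open U -> finite_dim W ->
  (forall c : W -> R, clinear c -> Ck k U (c \o f)) -> Ck k U f.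
Proof.
move=> oU [I [b [c [cl cE]]]] H.
have -> : f = fun x => \sum_i c i (f x) *: b i by apply/funext => x; rewrite -cE.
apply: Ck_sum => // i.
exact: (Ck_clinear_comp oU (clinear_scalel (b i)) (H _ (cl i))).
Qed.

Lemma CkZ V W k (U : set V) (f : V -> R) (g : V -> W) : open U -> finite_dim W ->
  Ck k U f -> Ck k U g -> Ck k U (fun x => f x *: g x).
Proof.
move=> oU fW cf cg; apply: Ck_coords => // c cl.
rewrite (_ : _ \o _ = fun x => f x * c (g x)).
  by apply: CkM => //; exact: (Ck_clinear_comp oU cl).
by apply/funext => x /=; rewrite clinearZ.
Qed.

Lemma derive_comp_coords V W (I : finType) (b : I -> V) (c : I -> V -> R)
    (U : normedModType R) (f : V -> W) (g : U -> V) x v :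
  (forall v, v = \sum_i c i v *: b i) ->
  differentiable g x -> differentiable f (g x) ->
  'D_v (f \o g) x = \sum_i c i ('D_v g x) *: 'D_(b i) f (g x).
Proof.
move=> cE dg df; rewrite deriveE; last exact: differentiable_comp.
rewrite diff_comp//= -(deriveE v dg) [X in 'd f (g x) X]cE linear_sum.
by apply: eq_bigr => i _; rewrite linearZ/= -deriveE.
Qed.

Lemma Ck_comp (V' V W : normedModType R) k (U' : set V') (U : set V) (f : V -> W) (g : V' -> V) :
  open U' -> open U -> finite_dim V -> finite_dim W -> (forall x, U' x -> U (g x)) ->
  Ck k U f -> Ck k U' g -> Ck k U' (f \o g).
Proof.
move=> oU' oU fV fW gU; elim: k f => [|k IH] f cf cg; (split;
  first by (move=> x Ux; apply: differentiable_comp;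
    [exact: Ck_differentiable cg Ux|exact: Ck_differentiable cf (gU _ Ux)])) => // v.
have [I [b [c [cl cE]]]] := fV.
apply: (@Ck_ext _ _ k U' (fun x => \sum_i c i ('D_v g x) *: 'D_(b i) f (g x))) => //.
  move=> x Ux; rewrite (derive_comp_coords _ cE)//.
    exact: Ck_differentiable cg Ux.
  exact: Ck_differentiable cf (gU _ Ux).
apply: Ck_sum => // i; apply: CkZ => //.
  exact: (Ck_clinear_comp oU' (cl i) (cg.2 v)).
by apply: (IH (fun y => 'D_(b i) f y)); [exact: cf.2|exact: CkW].
Qed.

Section Smooth.
Context (V W : normedModType R) (U : set V).
Hypothesis oU : open U.

Lemma smooth_ext (f g : V -> W) :
  (forall x, U x -> f x = g x) -> smooth_on U f -> smooth_on U g.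
Proof. by move=> fg /smooth_onP sf; apply/smooth_onP => k; exact: (Ck_ext oU fg). Qed.

Lemma smooth_cst (w : W) : smooth_on U (fun=> w).
Proof. by apply/smooth_onP => k; exact: Ck_cst. Qed.

Lemma smooth_clinear (L : V -> W) : clinear L -> smooth_on U L.
Proof. by move=> Ll; apply/smooth_onP => k; exact: Ck_clinear. Qed.

Lemma smoothD (f g : V -> W) :
  smooth_on U f -> smooth_on U g -> smooth_on U (fun x => f x + g x).
Proof.
by move=> /smooth_onP sf /smooth_onP sg; apply/smooth_onP => k; exact: (CkD oU).
Qed.

Lemma smooth_sum (I : Type) (r : seq I) (f : I -> V -> W) :
  (forall i, smooth_on U (f i)) -> smooth_on U (fun x => \sum_(i <- r) f i x).
Proof.
move=> sf; apply/smooth_onP => k; apply: (Ck_sum _ oU) => i.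
by have /smooth_onP := sf i.
Qed.

Lemma smooth_clinear_comp (W' : normedModType R) (f : V -> W) (L : W -> W') :
  clinear L -> smooth_on U f -> smooth_on U (L \o f).
Proof.
by move=> Ll /smooth_onP sf; apply/smooth_onP => k; exact: (Ck_clinear_comp oU).
Qed.

Lemma smoothZ (f : V -> R) (g : V -> W) : finite_dim W ->
  smooth_on U f -> smooth_on U g -> smooth_on U (fun x => f x *: g x).
Proof.
by move=> fW /smooth_onP sf /smooth_onP sg; apply/smooth_onP => k; exact: (CkZ oU).
Qed.

Lemma smoothB (f g : V -> W) :
  smooth_on U f -> smooth_on U g -> smooth_on U (fun x => f x - g x).
Proof.
move=> sf sg; apply: smoothD => //.
have Nl : clinear (fun w : W => - w).
  by split=> [a u v|x]; [rewrite opprD scalerN|exact: opp_continuous].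
exact: (smooth_clinear_comp Nl sg).
Qed.

Lemma smooth_comp (V' : normedModType R) (U' : set V') (f : V -> W) (g : V' -> V) :
  open U' -> finite_dim V -> finite_dim W -> (forall x, U' x -> U (g x)) ->
  smooth_on U f -> smooth_on U' g -> smooth_on U' (f \o g).
Proof.
move=> oU' fV fW gU /smooth_onP sf /smooth_onP sg; apply/smooth_onP => k.
exact: (Ck_comp oU' oU).
Qed.

End Smooth.

Lemma clinear_inl V W : clinear (fun v : V => (v, 0 : W)).
Proof.
split=> [a u v|x].
  by apply: injective_projections => //=; rewrite scaler0 addr0.
by apply: cvg_pair => /=; [exact: cvg_id|exact: cvg_cst].
Qed.

Lemma clinear_inr V W : clinear (fun w : W => (0 : V, w)).
Proof.
split=> [a u v|x].
  by apply: injective_projections => //=; rewrite scaler0 addr0.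
by apply: cvg_pair => /=; [exact: cvg_cst|exact: cvg_id].
Qed.

Lemma smooth_pair (V W W' : normedModType R) (U : set V) (f : V -> W) (g : V -> W') : open U ->
  smooth_on U f -> smooth_on U g -> smooth_on U (fun x => (f x, g x)).
Proof.
move=> oU sf sg; apply: (@smooth_ext _ _ _ oU (fun x => (f x, 0) + (0, g x))).
  by move=> x _; apply: injective_projections => /=; rewrite ?addr0 ?add0r.
apply: smoothD => //.
- exact: (smooth_clinear_comp oU (clinear_inl W W') sf).
- exact: (smooth_clinear_comp oU (clinear_inr W W') sg).
Qed.

Lemma smooth_mx (V : normedModType R) m n (U : set V) (f : V -> 'M[R]_(m, n)) : open U ->
  (forall i j, smooth_on U (fun x => f x i j)) -> smooth_on U f.
Proof.
move=> oU sf.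
have -> : f = fun x => \sum_i \sum_j f x i j *: delta_mx i j.
  by apply/funext => x; exact: matrix_sum_delta.
apply: smooth_sum => // i; apply: smooth_sum => // j.
exact: (smooth_clinear_comp oU (clinear_scalel _) (sf i j)).
Qed.

End SmoothCalculus.

(** * Orders in h, locally uniformly in the other variable *)

Section LocalOrder.
Context {R : realType}.
Implicit Types V W : normedModType R.

(** The parameter ranges over any normed space, so that the bound can be uniform in x or in a whole
    jet. The neighbourhood is not punctured: for positive [r] the value at the centre must be 0. *)
Definition Oloc V W (r : nat) (y0 : V) (u : R * V -> W) : Prop :=
  exists2 C : R, 0 < C & \forall p \near ((0, y0) : R * V), `|u p| <= C * `|p.1| ^+ r.

Lemma Oh_nextP W N al be (F : R -> R -> W) :
  Oh_next N al be F <->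
  forall x0, al < x0 < be -> Oloc N.+1 x0 (fun p : R * R => F p.1 p.2).
Proof.
split=> H x0 x0I; first have /eqO_exP[C C0 HC] := H _ x0I.
  by exists C => //; apply: filterS HC => p; rewrite normrX.
have [C C0 HC] := H _ x0I; apply/eqO_exP; exists C => //.
by apply: filterS HC => p; rewrite normrX.
Qed.

Section At.
Context {V : normedModType R} (y0 : V).

Lemma near_small : \forall p \near ((0, y0) : R * V), `|p.1| <= 1.
Proof.
have : (fun p : R * V => `|p.1|) @ (0, y0) --> `|0 : R|.
  by apply: cvg_norm; exact: cvg_fst.
rewrite normr0 => /cvgr_le; apply; exact: ltr01.
Qed.

Lemma Oloc_ext W r (u v : R * V -> W) :
  (\forall p \near ((0, y0) : R * V), u p = v p) -> Oloc r y0 u -> Oloc r y0 v.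
Proof.
move=> uv [C C0 HC]; exists C => //.
by apply: filterS2 uv HC => p <-.
Qed.

Lemma Oloc0 W r : Oloc r y0 (fun=> 0 : W).
Proof.
by exists 1 => //; apply: filterE => p; rewrite normr0 mul1r exprn_ge0.
Qed.

Lemma OlocD W r (u v : R * V -> W) :
  Oloc r y0 u -> Oloc r y0 v -> Oloc r y0 (fun p => u p + v p).
Proof.
move=> [C C0 HC] [D D0 HD]; exists (C + D); first exact: addr_gt0.
by apply: filterS2 HC HD => p up vp; rewrite mulrDl (le_trans (ler_normD _ _))// lerD.
Qed.

Lemma OlocN W r (u : R * V -> W) : Oloc r y0 u -> Oloc r y0 (fun p => - u p).
Proof. by move=> [C C0 HC]; exists C => //; apply: filterS HC => p; rewrite normrN. Qed.

Lemma OlocB W r (u v : R * V -> W) :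
  Oloc r y0 u -> Oloc r y0 v -> Oloc r y0 (fun p => u p - v p).
Proof. by move=> Ou /OlocN; exact: OlocD. Qed.

Lemma Oloc_subC W r (u v : R * V -> W) :
  Oloc r y0 (fun p => u p - v p) -> Oloc r y0 (fun p => v p - u p).
Proof. by move=> /OlocN; apply: Oloc_ext; apply: filterE => p; rewrite opprB. Qed.

Lemma Oloc_trans W r (u v w : R * V -> W) :
  Oloc r y0 (fun p => u p - v p) -> Oloc r y0 (fun p => v p - w p) ->
  Oloc r y0 (fun p => u p - w p).
Proof.
move=> Ou Ov; apply: Oloc_ext (OlocD Ou Ov); apply: filterE => p /=.
by rewrite addrA subrK.
Qed.

Lemma Oloc_sum W r (I : Type) (s : seq I) (P : pred I) (u : I -> R * V -> W) :
  (forall i, P i -> Oloc r y0 (u i)) -> Oloc r y0 (fun p => \sum_(i <- s | P i) u i p).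
Proof.
move=> Ou; elim: s => [|i s IH].
  by apply: Oloc_ext (Oloc0 _ _); apply: filterE => p; rewrite big_nil.
have [Pi|Pi] := boolP (P i); last first.
  by apply: Oloc_ext IH; apply: filterE => p; rewrite big_cons (negbTE Pi).
apply: Oloc_ext (OlocD (Ou _ Pi) IH); apply: filterE => p.
by rewrite big_cons Pi.
Qed.

Lemma OlocW W r r' (u : R * V -> W) : (r' <= r)%N -> Oloc r y0 u -> Oloc r' y0 u.
Proof.
move=> rr [C C0 HC]; exists C => //; apply: filterS2 HC near_small => p up p1.
by apply: le_trans up _; rewrite ler_pM2l//; exact: ler_wiXn2l.
Qed.

Lemma Oloc_pow W r i (u : R * V -> W) :
  Oloc r y0 u -> Oloc (i + r) y0 (fun p => p.1 ^+ i *: u p).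
Proof.
move=> [C C0 HC]; exists C => //; apply: filterS HC => p up.
by rewrite normrZ normrX exprD mulrCA ler_wpM2l.
Qed.

Lemma Oloc_continuous W (u : R * V -> W) : {for (0, y0), continuous u} -> Oloc 0 y0 u.
Proof.
move=> cu; exists (`|u (0, y0)| + 1); first by rewrite ltr_wpDl.
have : (fun p => `|u p|) @ (0, y0) --> `|u (0, y0)| by apply: cvg_norm; exact: cu.
move=> /cvgr_le/(_ (`|u (0, y0)| + 1)); rewrite ltrDl ltr01 => /(_ isT).
by apply: filterS => p; rewrite expr0 mulr1.
Qed.

Lemma Oloc_clinear W (W' : normedModType R) r (u : R * V -> W) (L : W -> W') :
  clinear L -> Oloc r y0 u -> Oloc r y0 (L \o u).
Proof.
move=> /clinear_bound[k k0 Lk] [C C0 HC]; exists (k * C); first exact: mulr_gt0.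
apply: filterS HC => p up; apply: le_trans (Lk _) _.
by rewrite -mulrA ler_pM2l.
Qed.

Lemma Oloc_coords W r (u : R * V -> W) : finite_dim W ->
  (forall c : W -> R, clinear c -> Oloc r y0 (c \o u)) -> Oloc r y0 u.
Proof.
move=> [I [b [c [cl cE]]]] H.
have -> : u = fun p => \sum_i c i (u p) *: b i by apply/funext => p; rewrite -cE.
apply: Oloc_sum => i _.
exact: (Oloc_clinear (clinear_scalel (b i)) (H _ (cl i))).
Qed.

Lemma Oloc_center W r (u : R * V -> W) : Oloc r.+1 y0 u -> u (0, y0) = 0.
Proof.
move=> [C C0 /nbhs_singleton/=]; rewrite normr0 expr0n/= mulr0 normr_le0.
by move=> /eqP.
Qed.

End At.

Lemma is_derive_line V W (f : V -> W) (a v : V) (t : R) :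
  differentiable f (a + t *: v) ->
  is_derive t 1 (fun s : R => f (a + s *: v)) ('D_v f (a + t *: v)).
Proof.
move=> df; pose l := fun s : R => a + s *: v.
have dl : is_diff t l (fun s => s *: v).
  have -> : l = cst a + ( *:%R ^~ v) by [].
  by apply: is_diff_eq; rewrite add0r.
have dc : differentiable (f \o l) t by apply: differentiable_comp.
apply: DeriveDef; first exact: diff_derivable.
rewrite (deriveE _ dc) diff_comp//= (deriveE _ df); congr ('d _ _ _).
by rewrite diff_val scale1r.
Qed.

Lemma MVT_line V (f : V -> R) (a v : V) :
  (forall t : R, 0 <= t <= 1 -> differentiable f (a + t *: v)) ->
  exists2 t : R, 0 <= t <= 1 & f (a + v) - f a = 'D_v f (a + t *: v).
Proof.
move=> df; pose g (t : R) := f (a + t *: v).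
have dg (t : R) : 0 <= t <= 1 -> is_derive t 1 g ('D_v f (a + t *: v)).
  by move=> /df; exact: is_derive_line.
have [||t tI] := @MVT_segment R g (fun t => 'D_v f (a + t *: v)) 0 1 ler01.
- by move=> t /itvP tI; apply: dg; rewrite !tI.
- apply: derivable_within_continuous => t; rewrite in_itv /= => /dg dgt.
  exact: ex_derive.
rewrite /g scale1r scale0r addr0 subr0 mulr1 => ->.
by exists t => //; rewrite !(itvP tI).
Qed.

Lemma ball_segment V (y : V) (e : R) (y1 y2 : V) (t : R) : 0 <= t <= 1 ->
  ball y e y1 -> ball y e y2 -> ball y e (y2 + t *: (y1 - y2)).
Proof.
rewrite -ball_normE /= => /andP[t0 t1] y1e y2e.
have -> : y - (y2 + t *: (y1 - y2)) = (1 - t) *: (y - y2) + t *: (y - y1).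
  rewrite scalerBl scale1r opprD addrA -[RHS]addrA; congr (_ + _).
  by rewrite -!scalerN -scalerDr !opprB addrA subrK.
apply: le_lt_trans (ler_normD _ _) _; rewrite !normrZ (ger0_norm t0) ger0_norm ?subr_ge0//.
have [->|tn0] := eqVneq t 0; first by rewrite subr0 mul0r addr0 mul1r.
have t_gt0 : 0 < t by rewrite lt_neqAle eq_sym tn0.
apply: (@lt_le_trans _ _ ((1 - t) * e + t * e)); last by rewrite -mulrDl subrK mul1r.
by rewrite ler_ltD// ?ler_wpM2l ?subr_ge0 ?(ltW y2e)// ltr_pM2l.
Qed.

(** Both arguments vary, because the estimate is applied to two families of points that share only
    their centre. *)
Definition lipschitz_near V W (f : V -> W) (y : V) : Prop :=
  exists2 C : R, 0 < C &
    \forall p \near ((y, y) : V * V), `|f p.1 - f p.2| <= C * `|p.1 - p.2|.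

Lemma lipschitz_nearD V W (f g : V -> W) (y : V) :
  lipschitz_near f y -> lipschitz_near g y -> lipschitz_near (fun x => f x + g x) y.
Proof.
move=> [C C0 HC] [D D0 HD]; exists (C + D); first exact: addr_gt0.
apply: filterS2 HC HD => p fp gp.
rewrite opprD addrACA mulrDl (le_trans (ler_normD _ _))// lerD//.
Qed.

Lemma lipschitz_near_sum V W (I : Type) (s : seq I) (f : I -> V -> W) (y : V) :
  (forall i, lipschitz_near (f i) y) -> lipschitz_near (fun x => \sum_(i <- s) f i x) y.
Proof.
move=> lf; elim: s => [|i s IH].
  exists 1 => //; apply: filterE => p.
  by rewrite !big_nil subrr normr0 mul1r.
have -> : (fun x => \sum_(j <- i :: s) f j x) = fun x => f i x + \sum_(j <- s) f j x.
  by apply/funext => x; rewrite big_cons.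
exact: lipschitz_nearD.
Qed.

Lemma lipschitz_near_clinear V W (W' : normedModType R) (f : V -> W) (L : W -> W') (y : V) :
  clinear L -> lipschitz_near f y -> lipschitz_near (L \o f) y.
Proof.
move=> Ll; have /clinear_bound[k k0 Lk] := Ll.
move=> [C C0 HC]; exists (k * C); first exact: mulr_gt0.
apply: filterS HC => p fp /=; rewrite -clinearB//; apply: le_trans (Lk _) _.
by rewrite -mulrA ler_pM2l.
Qed.

Lemma smooth_lipschitz_near_scalar V (U : set V) (f : V -> R) (y : V) :
  finite_dim V -> open U -> smooth_on U f -> U y -> lipschitz_near f y.
Proof.
move=> [I [b [c [cl cE]]]] oU sf Uy.
have /choice[K cK] : forall i, exists k : R, 0 < k /\ forall x, `|c i x| <= k * `|x|.
  by move=> i; have /clinear_bound[k k0 Hk] := cl i; exists k.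
(* By continuity [A i] bounds a directional derivative near [y]. The mean value theorem on a ball,
   which is convex, turns these bounds into a Lipschitz constant; the leading 1 in that constant
   keeps it positive. *)
pose A i := `|'D_(b i) f y| + 1.
have A0 i : 0 < A i by rewrite ltr_wpDl.
have DA : \forall z \near y, U z /\ forall i, `|'D_(b i) f z| <= A i.
  apply: filterI; first exact: open_nbhs_nbhs.
  apply: filter_forall => i.
  have : (fun z => `|'D_(b i) f z|) @ y --> `|'D_(b i) f y|.
    apply: cvg_norm.
    exact: (differentiable_continuous (smooth_differentiable (smooth_derive (b i) sf) Uy)).
  by move=> /cvgr_le; apply; rewrite ltrDl.
have [e e0 eA] := (nbhs_ballP _ _).1 DA.
exists (1 + \sum_i K i * A i).
  by rewrite ltr_pwDl// sumr_ge0// => i _; rewrite mulr_ge0// ?ltW ?(cK i).1.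
exists (ball y e, ball y e); first by split; exact: nbhsx_ballx.
move=> [y1 y2] [/= y1e y2e].
have seg (t : R) : 0 <= t <= 1 -> ball y e (y2 + t *: (y1 - y2)).
  by move=> tI; exact: ball_segment.
have [|t tI] := @MVT_line V f y2 (y1 - y2).
  by move=> t /seg /eA[Uz _]; exact: smooth_differentiable sf Uz.
rewrite [y2 + _]addrC subrK /= => ->.
have [Uz zA] := eA _ (seg _ tI).
have df := smooth_differentiable sf Uz.
rewrite deriveE// [X in 'd _ _ X]cE linear_sum mulrDl mul1r mulr_suml.
apply: le_trans (ler_norm_sum _ _ _) _; rewrite ler_wpDl//.
apply: ler_sum => i _; rewrite linearZ/= -deriveE// normrM.
by rewrite mulrAC ler_pM// ?(cK i).2.
Qed.

Lemma smooth_lipschitz_near V W (U : set V) (f : V -> W) (y : V) :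
  finite_dim V -> finite_dim W -> open U -> smooth_on U f -> U y -> lipschitz_near f y.
Proof.
move=> fV [I [b [c [cl cE]]]] oU sf Uy.
have -> : f = fun p => \sum_i c i (f p) *: b i by apply/funext => p; rewrite -cE.
apply: lipschitz_near_sum => i.
apply: (lipschitz_near_clinear (clinear_scalel (b i))).
apply: smooth_lipschitz_near_scalar Uy => //.
exact: (smooth_clinear_comp oU (cl i) sf).
Qed.

(** For positive [r] the hypothesis forces both families to have the same centre, where [f] is
    locally Lipschitz. For [r = 0] the centres may differ, but then only local boundedness is
    claimed. *)
Lemma Oloc_smooth_comp (X V W : normedModType R) (U : set X) (f : X -> W)
    (u1 u2 : R * V -> X) r (y0 : V) :
  finite_dim X -> finite_dim W -> open U -> smooth_on U f ->
  U (u1 (0, y0)) -> U (u2 (0, y0)) ->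
  {for (0, y0), continuous u1} -> {for (0, y0), continuous u2} ->
  Oloc r y0 (fun p => u1 p - u2 p) -> Oloc r y0 (fun p => f (u1 p) - f (u2 p)).
Proof.
move=> fX fW oU sf Uu1 Uu2 cu1 cu2; case: r => [_|r Ou].
  apply: OlocB; apply: Oloc_continuous.
    apply: (continuous_comp cu1); apply: differentiable_continuous.
    exact: smooth_differentiable sf Uu1.
  apply: (continuous_comp cu2); apply: differentiable_continuous.
  exact: smooth_differentiable sf Uu2.
have u12 : u1 (0, y0) = u2 (0, y0) by apply/eqP; rewrite -subr_eq0; apply/eqP/(Oloc_center Ou).
have [C C0 HC] := smooth_lipschitz_near fX fW oU sf Uu1.
have cu : (fun p => (u1 p, u2 p)) @ (0, y0) --> (u1 (0, y0), u1 (0, y0)).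
  by apply: cvg_pair => /=; [exact: cu1|rewrite u12; exact: cu2].
have Hu : \forall p \near ((0, y0) : R * V),
  `|f (u1 p) - f (u2 p)| <= C * `|u1 p - u2 p| by exact: (cu _ HC).
have [D D0 HD] := Ou; exists (C * D); first exact: mulr_gt0.
apply: filterS2 Hu HD => p fp up; apply: le_trans fp _.
by rewrite -mulrA ler_pM2l.
Qed.

End LocalOrder.

(** * Partial derivatives and Taylor expansion in h *)

Section Slices.
Context {R : realType}.
Implicit Types V W : normedModType R.

Definition dh V W (f : R * V -> W) : R * V -> W := fun p => 'D_((1, 0) : R * V) f p.

Definition dx W (f : R * R -> W) : R * R -> W := fun p => 'D_((0, 1) : R * R) f p.

(** Both sides are limits of literally the same difference quotient, hence no differentiability is
    assumed. *)
Lemma derive1_dh V W (f : R * V -> W) (h : R) (y : V) :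
  derive1 (fun s => f (s, y)) h = dh f (h, y).
Proof.
rewrite /derive1 /dh /derive; set u := (fun _ : R => _); set w := (fun _ : R => _).
suff -> : u = w by []; apply/funext => s; rewrite /u /w /=.
congr (_ *: (f _ - _)).
by apply: injective_projections; rewrite /= ?scaler0 ?add0r// [_ *: _]mulr1.
Qed.

Lemma derive1n_dh V W (f : R * V -> W) i (y : V) :
  derive1n i (fun s => f (s, y)) = fun h : R => iter i (@dh V W) f (h, y).
Proof.
elim: i => [//|i IH]; rewrite derive1nS IH; apply/funext => h.
by rewrite derive1_dh.
Qed.

Lemma derive1_dx W (f : R * R -> W) (h x : R) :
  derive1 (fun y => f (h, y)) x = dx f (h, x).
Proof.
rewrite /derive1 /dx /derive; set u := (fun _ : R => _); set w := (fun _ : R => _).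
suff -> : u = w by []; apply/funext => s; rewrite /u /w /=.
congr (_ *: (f _ - _)).
by apply: injective_projections; rewrite /= ?scaler0 ?add0r// [_ *: _]mulr1.
Qed.

Lemma derive1n_dx W (f : R * R -> W) i (h : R) :
  derive1n i (fun y => f (h, y)) = fun x : R => iter i (@dx W) f (h, x).
Proof.
elim: i => [//|i IH]; rewrite derive1nS IH; apply/funext => x.
by rewrite derive1_dx.
Qed.

Lemma dxB W (f g : R * R -> W) p :
  differentiable f p -> differentiable g p ->
  dx (fun q => f q - g q) p = dx f p - dx g p.
Proof. by move=> df dg; exact: (deriveB (diff_derivable df) (diff_derivable dg)). Qed.

Lemma smooth_iter_derive V W (U : set V) (f : V -> W) v i :
  smooth_on U f -> smooth_on U (iter i (fun g y => 'D_v g y) f).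
Proof. by move=> sf; elim: i => [//|i IH] /=; exact: smooth_derive. Qed.

Lemma smooth_dh V W (U : set (R * V)) (f : R * V -> W) :
  smooth_on U f -> smooth_on U (dh f).
Proof. exact: smooth_derive. Qed.

Lemma smooth_dx W (U : set (R * R)) (f : R * R -> W) : smooth_on U f -> smooth_on U (dx f).
Proof. exact: smooth_derive. Qed.

Lemma iter_derive_clinear V W (W' : normedModType R) (U : set V) (f : V -> W) (L : W -> W') v i x :
  open U -> clinear L -> smooth_on U f -> U x ->
  iter i (fun g y => 'D_v g y) (L \o f) x = L (iter i (fun g y => 'D_v g y) f x).
Proof.
move=> oU Ll sf; elim: i x => [//|i IH] x Ux /=.
transitivity ('D_v (L \o iter i (fun g y => 'D_v g y) f) x).
  by apply: near_eq_derive; exact: open_near oU Ux IH.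
rewrite derive_clinear_comp//.
exact: smooth_differentiable (smooth_iter_derive v i sf) Ux.
Qed.

Definition taylor V W r (f : R * V -> W) (p : R * V) : W :=
  \sum_(i < r) p.1 ^+ i *: ((i`!%:R)^-1 *: iter i (@dh V W) f (0, p.2)).

Lemma derive_scale V W (f : V -> W) a x v :
  differentiable f x -> 'D_(a *: v) f x = a *: 'D_v f x.
Proof. by move=> df; rewrite !deriveE// linearZ. Qed.

Lemma MVT_bound (g dg : R -> R) (h B : R) :
  (forall s : R, `|s| <= `|h| -> is_derive s 1 g (dg s)) ->
  (forall s : R, `|s| <= `|h| -> `|dg s| <= B) -> `|g h - g 0| <= B * `|h|.
Proof.
move=> Hg HB.
have th (t : R) : 0 <= t <= 1 -> `|0 + t *: h| <= `|h|.
  by move=> /andP[t0 t1]; rewrite add0r normrZ ger0_norm// ler_piMl.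
have dg_ (t : R) : 0 <= t <= 1 -> differentiable g (0 + t *: h).
  by move=> /th /Hg ds; apply/derivable1_diffP; exact: ex_derive.
have [t tI] := MVT_line dg_.
have tH := th _ tI; rewrite add0r => ->.
have := @derive_scale R R g h (0 + t *: h) (1 : R) (dg_ _ tI).
have h1 : h *: (1 : R) = h by exact: mulr1.
rewrite h1 => ->.
have -> : 'D_(1 : R) g (0 + t *: h) = dg (0 + t *: h) by have ds := Hg _ tH; exact: derive_val.
by rewrite normrM mulrC ler_wpM2r// HB.
Qed.

(** The factorials make differentiation a shift of the coefficients, which matches the passage from
    [f] to [dh f] in a Taylor remainder. *)
Lemma is_derive_taylor_poly (a : nat -> R) r (s : R) :
  is_derive s 1 (fun s : R => \sum_(i < r.+1) s ^+ i * ((i`!%:R)^-1 * a i))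
    (\sum_(i < r) s ^+ i * ((i`!%:R)^-1 * a i.+1)).
Proof.
pose P : {poly R} := \poly_(i < r.+1) ((i`!%:R)^-1 * a i).
have -> : (fun s : R => \sum_(i < r.+1) s ^+ i * ((i`!%:R)^-1 * a i)) = horner P.
  by apply/funext => t; rewrite horner_poly; apply: eq_bigr => i _; rewrite mulrC.
apply: is_derive_eq; rewrite (@horner_coef_wide _ r); last first.
  rewrite (leq_trans (size_poly _ _))//.
  by have := size_poly r.+1 (fun i => (i`!%:R)^-1 * a i); case: (size _).
apply: eq_bigr => i _; rewrite coef_deriv coef_poly ltnS ltn_ord mulrC; congr (_ * _).
rewrite -[LHS]mulr_natl factS natrM invfM -!mulrA mulVKf//.
Qed.

(** Induction on [r]: the h-derivative of the remainder of order [r.+1] of [f] is the remainder of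
    order [r] of [dh f], and the mean value bound between 0 and h gains a factor |h|. The constant
    [C] is kept. *)
Lemma taylor_Oloc_scalar V (U : set (R * V)) (f : R * V -> R) (y0 : V) r :
  open U -> smooth_on U f -> U (0, y0) -> Oloc r y0 (fun p => f p - taylor r f p).
Proof.
move=> oU sf Uy0; elim: r f sf => [|r IH] f sf.
  apply: (@Oloc_ext _ _ _ _ 0 f); first by apply: filterE => p; rewrite /taylor big_ord0 subr0.
  apply: Oloc_continuous.
  exact: (differentiable_continuous (smooth_differentiable sf Uy0)).
have [C C0 HC] := IH _ (smooth_dh sf).
exists C => //.
have : \forall p \near ((0, y0) : R * V), U p /\ `|dh f p - taylor r (dh f) p| <= C * `|p.1| ^+ r.
  by apply: filterI => //; exact: open_nbhs_nbhs.
move=> /nbhs_ballP[e e0 He]; apply/nbhs_ballP; exists e => //.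
move=> [h y] hy /=.
(* A ball of the product contains, with (h, y), the whole segment from (0, y) to (h, y), so a single
   constant serves all [y]. *)
have Hs (s : R) : `|s| <= `|h| -> U (s, y) /\
    `|dh f (s, y) - taylor r (dh f) (s, y)| <= C * `|s| ^+ r.
  move=> sh; apply: (He (s, y)); case: hy => /= hy1 hy2; split=> //=.
  by move: hy1; rewrite -!ball_normE /= !sub0r !normrN; exact: le_lt_trans.
pose a i := iter i (@dh V R) f (0, y).
pose g (s : R) := f (s, y) - \sum_(i < r.+1) s ^+ i * ((i`!%:R)^-1 * a i).
pose dg (s : R) := dh f (s, y) - \sum_(i < r) s ^+ i * ((i`!%:R)^-1 * a i.+1).
have := @MVT_bound g dg h (C * `|h| ^+ r).
have -> : g 0 = 0.
  rewrite /g big_ord_recl expr0 mul1r fact0 invr1 mul1r big1 ?addr0 ?subrr//.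
  by move=> i _; rewrite expr0n mul0r.
rewrite subr0 -mulrA -exprSr; apply=> s sh; have [Us ds] := Hs _ sh.
  apply: is_deriveB; last exact: is_derive_taylor_poly.
  have := @is_derive_line _ _ _ f (0, y) (1, 0) s.
  have line t : ((0, y) + t *: (1, 0) : R * V) = (t, y).
    apply: injective_projections => /=; first by rewrite add0r [_ *: _]mulr1.
    by rewrite scaler0 addr0.
  rewrite line (_ : (fun s : R => _) = (fun s : R => f (s, y))); last first.
    by apply/funext => t; rewrite line.
  by apply; exact: smooth_differentiable sf Us.
apply: le_trans (_ : C * `|s| ^+ r <= _); last by rewrite ler_pM2l// lerXn2r ?nnegrE.
apply: le_trans ds; rewrite /dg /taylor /a.
by under [X in _ <= `|_ - X|]eq_bigr do rewrite -iterSr.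
Qed.

Lemma taylor_clinear V W (W' : normedModType R) (U : set (R * V)) (f : R * V -> W)
    (L : W -> W') r p :
  open U -> clinear L -> smooth_on U f -> U (0, p.2) ->
  taylor r (L \o f) p = L (taylor r f p).
Proof.
move=> oU Ll sf Up; rewrite /taylor clinear_sum//; apply: eq_bigr => i _.
rewrite (clinearZ _ _ Ll) (clinearZ _ _ Ll); congr (_ *: (_ *: _)).
exact: (iter_derive_clinear _ _ oU Ll sf Up).
Qed.

Lemma near_section V (U : set (R * V)) (y0 : V) : open U -> U (0, y0) ->
  \forall p \near ((0, y0) : R * V), U (0, p.2).
Proof.
move=> oU Uy0.
have cu : (fun p : R * V => (0 : R, p.2)) @ (0, y0) --> (0 : R, y0).
  exact: ((clinear_comp (clinear_inr R V) (clinear_snd R V)).2 (0, y0)).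
exact: (cu _ (open_nbhs_nbhs (conj oU Uy0))).
Qed.

Lemma taylor_Oloc V W (U : set (R * V)) (f : R * V -> W) (y0 : V) r :
  finite_dim W -> open U -> smooth_on U f -> U (0, y0) ->
  Oloc r y0 (fun p => f p - taylor r f p).
Proof.
move=> fW oU sf Uy0; apply: Oloc_coords => // c cl.
apply: Oloc_ext (taylor_Oloc_scalar r oU (smooth_clinear_comp oU cl sf) Uy0).
apply: filterS (near_section oU Uy0) => p Up /=.
by rewrite clinearB// (taylor_clinear r oU cl sf Up).
Qed.

(** * Differentiating order bounds in x *)

Section SpaceDerivative.
Context (U : set (R * R)) (oU : open U).

Lemma dx_increment (f : R * R -> R) (h x d : R) : smooth_on U f ->
  (forall t : R, 0 <= t <= 1 -> U (h, x + t * d)) ->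
  exists2 t : R, 0 <= t <= 1 & f (h, x + d) - f (h, x) = d * dx f (h, x + t * d).
Proof.
move=> sf HU.
have line (t : R) : ((h, x) + t *: (0, d) : R * R) = (h, x + t * d).
  by apply: injective_projections => //=; rewrite scaler0 addr0.
have df (t : R) : 0 <= t <= 1 -> differentiable f ((h, x) + t *: (0, d)).
  by move=> tI; rewrite line; exact: smooth_differentiable sf (HU _ tI).
have [t tI E] := MVT_line df; exists t => //.
have line1 := line 1; rewrite scale1r mul1r in line1.
rewrite -line1 E -line /dx; have := derive_scale d ((0, 1) : R * R) (df _ tI).
move=> Ed; rewrite [RHS](esym Ed).
congr (derive _ _ _); apply: injective_projections => /=; first by rewrite scaler0.
by rewrite [_ *: _]mulr1.
Qed.

(* The lowest nonzero Taylor coefficient [a_s(x)] of [dx f] would make [f] grow like [h^s] between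
   two nearby points [x0 < x1], although [f] is [O(h^r)] at both. *)
Lemma taylor_dx_eq0 (f : R * R -> R) (r : nat) : smooth_on U f ->
  (forall x, U (0, x) -> Oloc r x f) ->
  forall s x, (s < r)%N -> U (0, x) -> iter s (@dh R R) (dx f) (0, x) = 0.
Proof.
move=> sf Of s; elim/ltn_ind: s => s IH x0 sr Ux0.
set X := dx f in IH *.
have sX : smooth_on U X by exact: smooth_dx.
pose be x := (s`!%:R)^-1 * iter s (@dh R R) X (0, x).
suff : be x0 = 0.
  by move/eqP; rewrite mulf_eq0 invr_eq0 pnatr_eq0 gtn_eqF ?fact_gt0// orFb => /eqP.
apply/eqP; apply/negP => /negP be0.
pose al := `|be x0| / 2.
have al0 : 0 < al by rewrite divr_gt0// normr_gt0.
have OX := taylor_Oloc s.+1 finite_dim_R oU sX Ux0.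
have [C C0 HC] := OX.
have cbe : {for (0, x0), continuous (fun p : R * R => be p.2)}.
  have c0 : (fun p : R * R => (0 : R, p.2)) @ (0, x0) --> (0 : R, x0).
    exact: ((clinear_comp (clinear_inr R R) (clinear_snd R R)).2 (0, x0)).
  have sXs : smooth_on U (iter s (@dh R R) X) by exact: smooth_iter_derive.
  have cX := differentiable_continuous (smooth_differentiable sXs Ux0).
  have cX0 : (fun p : R * R => iter s (@dh R R) X (0, p.2)) @ (0, x0)
      --> iter s (@dh R R) X (0, x0).
    by move=> A /cX/c0.
  by apply: cvgM => //; exact: cvg_cst.
have near_be : \forall p \near ((0, x0) : R * R), `|be x0 - be p.2| <= al.
  by move/cvgrPdist_le : cbe => /(_ _ al0).
have near_U : \forall p \near ((0, x0) : R * R), U p by exact: open_nbhs_nbhs.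
(* The coefficients below [s] vanish by induction. The first error term is the Taylor remainder; the
   second is the variation of [be], kept below half of |[be x0]|. *)
have : \forall p \near ((0, x0) : R * R),
    [/\ U p, U (0, p.2) & `|X p - p.1 ^+ s * be x0| <= C * `|p.1| ^+ s.+1 + `|p.1| ^+ s * al].
  near=> p.
  have Up : U p by near: p.
  have Up0 : U (0, p.2) by near: p; exact: near_section.
  split=> //.
  have -> : X p - p.1 ^+ s * be x0 = (X p - taylor s.+1 X p) - p.1 ^+ s * (be x0 - be p.2).
    rewrite /taylor big_ord_recr /= big1 ?add0r.
      rewrite -/(be _) mulrBr opprB addrA; congr (_ - _).
      by rewrite [_ *: _]/(_ * _) -/(be p.2) subrK.
    move=> i _; rewrite (IH i) ?scaler0//; exact: ltn_trans sr.
  apply: le_trans (ler_normB _ _) _; apply: lerD; first by near: p.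
  by rewrite normrM normrX ler_wpM2l//; near: p.
move=> /nbhs_ballP[e /= e0 He].
pose d := e / 2; have d0 : 0 < d by rewrite divr_gt0.
have de : d < e by rewrite ltr_pdivrMr// mulr_natr mulr2n ltrDl.
have ballP (h t : R) : `|h| < e -> 0 <= t <= 1 -> ball ((0, x0) : R * R) e (h, x0 + t * d).
  move=> he /andP[t0 t1]; split; rewrite /= -ball_normE /=.
    by rewrite sub0r normrN.
  rewrite opprD addNKr normrN ger0_norm ?mulr_ge0// ?ltW//.
  by apply: le_lt_trans de; rewrite ler_piMl// ltW.
have Ux1 : U (0, x0 + d).
  have b1 := ballP 0 1; rewrite mul1r normr0 ler01 lexx in b1.
  by have [] := He _ (b1 e0 isT).
(* The range of h on which the bound on [f] holds may depend on x; only the two end points [x0] and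
   [x0 + d] are used. *)
have at_x (x : R) : U (0, x) -> exists2 D : R, 0 < D &
    \forall h \near (0 : R), `|f (h, x)| <= D * `|h| ^+ r.
  move=> Ux; have [D D0 HD] := Of _ Ux; exists D => //.
  have ch : (fun h : R => (h, x)) @ (0 : R) --> (0 : R, x).
    have -> : ((0 : R, x) : R * R) = (0, 0) + (0, x).
      by apply: injective_projections; rewrite /= ?addr0 ?add0r.
    have -> : (fun h : R => (h, x)) = (fun h : R => (h, 0) + ((0, x) : R * R)).
      by apply/funext => h; apply: injective_projections; rewrite /= ?addr0 ?add0r.
    by apply: cvgD; [exact: ((clinear_inl R R).2 0)|exact: cvg_cst].
  exact: (ch _ HD).
have [D0 D0gt HD0] := at_x _ Ux0.
have [D1 D1gt HD1] := at_x _ Ux1.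
(* The increment of [f] over the length [d] will give d * al * h^s <= B * h^(s+1): [D0] and [D1]
   come from the end points, [d * C] from the remainder of [X]. A small h contradicts this. *)
pose B := D0 + D1 + d * C.
have B0 : 0 < B by rewrite !addr_gt0// mulr_gt0.
near (0 : R)^'+ => h.
have h0 : 0 < h by near: h; exact: nbhs_right_gt.
have h1 : h <= 1 by near: h; exact: nbhs_right_le.
have he : `|h| < e by rewrite ger0_norm ?ltW//; near: h; exact: nbhs_right_lt.
have hB : B * h < d * al.
  rewrite mulrC -ltr_pdivlMr//; near: h; apply: nbhs_right_lt.
  by rewrite divr_gt0// mulr_gt0.
have fh0 : `|f (h, x0)| <= D0 * h ^+ s.+1.
  apply: (@le_trans _ _ (D0 * `|h| ^+ r)).
    by near: h; exact: cvg_within HD0.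
  by rewrite (ger0_norm (ltW h0)) ler_pM2l//; apply: ler_wiXn2l => //; exact: ltW.
have fh1 : `|f (h, x0 + d)| <= D1 * h ^+ s.+1.
  apply: (@le_trans _ _ (D1 * `|h| ^+ r)).
    by near: h; exact: cvg_within HD1.
  by rewrite (ger0_norm (ltW h0)) ler_pM2l//; apply: ler_wiXn2l => //; exact: ltW.
have [|t tI fE] := @dx_increment f h x0 d sf.
  by move=> t tI; have [] := He _ (ballP h t he tI).
have [_ _ /=] := He _ (ballP h t he tI).
rewrite (ger0_norm (ltW h0)) => Xt.
have hs0 : 0 < h ^+ s by rewrite exprn_gt0.
have lowX : h ^+ s * al - C * h ^+ s.+1 <= `|X (h, x0 + t * d)|.
  have := lerB_dist (h ^+ s * be x0) (X (h, x0 + t * d)).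
  rewrite distrC normrM (ger0_norm (ltW hs0)) => lowX.
  have alE : `|be x0| = al + al by rewrite /al -splitr.
  move: lowX; rewrite alE; lra.
have upX : d * `|X (h, x0 + t * d)| <= (D0 + D1) * h ^+ s.+1.
  rewrite -{1}(gtr0_norm d0) -normrM -fE [D0 + D1]addrC mulrDl.
  by apply: le_trans (ler_normB _ _) _; exact: lerD.
have : d * al * h ^+ s <= B * h * h ^+ s.
  rewrite /B; rewrite !exprSr in lowX upX.
  have := ler_wpM2l (ltW d0) lowX; lra.
by rewrite ler_pM2r// leNgt hB.
Unshelve. all: by end_near. Qed.

(** The Taylor coefficients of [dx f] in h vanish below order [r], so [dx f] coincides with its own
    Taylor remainder. Coordinates reduce this to scalar functions, for which the mean value theorem
    is an equality. *)
Lemma Oloc_dx W (f : R * R -> W) r : finite_dim W -> smooth_on U f ->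
  (forall x, U (0, x) -> Oloc r x f) -> forall x, U (0, x) -> Oloc r x (dx f).
Proof.
move=> fW sf Of x Ux; apply: Oloc_coords => // c cl.
pose g := c \o f.
have sg : smooth_on U g by exact: (smooth_clinear_comp oU cl sf).
have Og y : U (0, y) -> Oloc r y g by move=> /Of Oy; exact: Oloc_clinear.
apply: (@Oloc_ext _ _ _ _ _ (dx g)).
  have : \forall p \near ((0, x) : R * R), U p by exact: open_nbhs_nbhs.
  apply: filterS => p Up; rewrite /dx derive_clinear_comp//.
  exact: smooth_differentiable sf Up.
apply: Oloc_ext (taylor_Oloc r finite_dim_R oU (smooth_dx sg) Ux).
apply: filterS (near_section oU Ux) => p Up.
rewrite /taylor big1 ?subr0// => i _.
by rewrite (taylor_dx_eq0 sg Og) ?scaler0.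
Qed.

End SpaceDerivative.

End Slices.

(** * Functions on jets *)

Section MatrixMaps.
Context {R : realType}.
Implicit Types V W : normedModType R.

Lemma clinear_cst0 V W : clinear (fun _ : V => 0 : W).
Proof. by split=> [a u v|x]; [rewrite scaler0 addr0|exact: cst_continuous]. Qed.

Lemma clinear_add V W (f g : V -> W) : clinear f -> clinear g -> clinear (fun x => f x + g x).
Proof.
move=> [fl fc] [gl gc]; split=> [a u v|x]; first by rewrite fl gl scalerDr addrACA.
by apply: cvgD; [exact: fc|exact: gc].
Qed.

Lemma clinear_bigsum V W (I : Type) (s : seq I) (f : I -> V -> W) :
  (forall i, clinear (f i)) -> clinear (fun x => \sum_(i <- s) f i x).
Proof.
move=> fl; elim: s => [|i s IH].
  have -> : (fun x => \sum_(i <- [::]) f i x) = fun=> 0 by apply/funext => x; rewrite big_nil.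
  exact: clinear_cst0.
have -> : (fun x => \sum_(j <- i :: s) f j x) = fun x => f i x + \sum_(j <- s) f j x.
  by apply/funext => x; rewrite big_cons.
exact: clinear_add.
Qed.

Lemma clinear_mx V m n (f : V -> 'M[R]_(m, n)) :
  (forall i j, clinear (fun x => f x i j)) -> clinear f.
Proof.
move=> fl.
have -> : f = fun x => \sum_i \sum_j f x i j *: delta_mx i j.
  by apply/funext => x; exact: matrix_sum_delta.
apply: clinear_bigsum => i; apply: clinear_bigsum => j.
exact: (clinear_comp (clinear_scalel _) (fl i j)).
Qed.

Lemma Oloc_mx V m n r (y0 : V) (f : R * V -> 'M[R]_(m, n)) :
  (forall i j, Oloc r y0 (fun p => f p i j)) -> Oloc r y0 f.
Proof.
move=> Of.
have -> : f = fun x => \sum_i \sum_j f x i j *: delta_mx i j.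
  by apply/funext => x; exact: matrix_sum_delta.
apply: Oloc_sum => i _; apply: Oloc_sum => j _.
exact: (Oloc_clinear (clinear_scalel _) (Of i j)).
Qed.

Lemma continuous_pair V (W W' : normedModType R) (f : V -> W) (g : V -> W') (x : V) :
  {for x, continuous f} -> {for x, continuous g} ->
  {for x, continuous (fun y => (f y, g y))}.
Proof. by move=> cf cg; apply: cvg_pair => /=; [exact: cf|exact: cg]. Qed.

Lemma Oloc_comp (V V' W : normedModType R) r (y0 : V) (x0 : V') (f : R * V -> W)
    (u : R * V' -> V) :
  {for (0, x0), continuous u} -> u (0, x0) = y0 -> Oloc r y0 f ->
  Oloc r x0 (fun p => f (p.1, u p)).
Proof.
move=> cu uy [C C0 HC]; exists C => //.
have cf : {for (0, x0), continuous (fun p : R * V' => (p.1, u p))}.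
  exact: (continuous_pair ((clinear_fst R V').2 _) cu).
by rewrite -uy in HC; exact: (cf _ HC).
Qed.

Lemma derive_comp V (W W' : normedModType R) (f : W -> W') (g : V -> W) x v :
  differentiable g x -> differentiable f (g x) ->
  'D_v (f \o g) x = 'D_('D_v g x) f (g x).
Proof.
move=> dg df; rewrite deriveE; last exact: differentiable_comp.
by rewrite diff_comp//= -(deriveE v dg) -deriveE.
Qed.

Lemma finite_dim_R_mx m n : finite_dim (R * 'M[R]_(m, n))%type.
Proof. by apply: finite_dim_prod; [exact: finite_dim_R|exact: finite_dim_mx]. Qed.

End MatrixMaps.

Section JetFunctions.
Context {R : realType} {n : nat} (Q : set 'rV[R]_n) (Q_open : open Q).
Implicit Types V W : normedModType R.

Let jets := nat -> 'rV[R]_n.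

Definition jet_dom K : set (R * 'M[R]_(K.+1, n)) := [set p | Q (row ord0 p.2)].
Arguments jet_dom : clear implicits.

Lemma clinear_row m i : clinear (@row R m n i).
Proof.
apply: clinear_mx => j l.
have -> : (fun x : 'M[R]_(m, n) => row i x j l) = fun x => x i l by apply/funext => x; rewrite mxE.
exact: clinear_coord.
Qed.

Lemma open_jet_dom K : open (jet_dom K).
Proof.
have rc : continuous (fun p : R * 'M[R]_(K.+1, n) => row ord0 p.2).
  exact: (clinear_comp (clinear_row ord0) (clinear_snd _ _)).2.
exact: open_comp (fun p _ => rc p) Q_open.
Qed.
Arguments open_jet_dom : clear implicits.

Lemma row_trunc K (z : jets) (j : 'I_K.+1) : row j (trunc K z) = z j.
Proof. by apply/rowP => s; rewrite !mxE. Qed.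

Lemma jet_dom_trunc K h (z : jets) : Q (z 0%N) -> jet_dom K (h, trunc K z).
Proof. by rewrite /jet_dom /= row_trunc. Qed.

(** A right inverse of [trunc K]; the padding by 0 is invisible to functions of order [K]. *)
Definition extend K (p : 'M[R]_(K.+1, n)) : jets :=
  fun j => if (j <= K)%N then row (inord j) p else 0.

Lemma trunc_extend K (p : 'M[R]_(K.+1, n)) : trunc K (extend p) = p.
Proof.
apply/matrixP => i j; rewrite mxE /extend -ltnS ltn_ord mxE.
by rewrite inord_val.
Qed.

Lemma extend0 K (p : 'M[R]_(K.+1, n)) : extend p 0%N = row ord0 p.
Proof. by rewrite /extend leq0n; congr row; apply/val_inj; rewrite /= inordK. Qed.

Lemma clinear_extend K j : clinear (fun p : 'M[R]_(K.+1, n) => extend p j).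
Proof. by rewrite /extend; case: leqP => _; [exact: clinear_row|exact: clinear_cst0]. Qed.

Lemma clinear_trunc V K (z : V -> jets) :
  (forall j, clinear (fun p => z p j)) -> clinear (fun p => trunc K (z p)).
Proof.
move=> zl; apply: clinear_mx => i s.
have -> : (fun p => trunc K (z p) i s) = fun p => z p i ord0 s by apply/funext => p; rewrite mxE.
exact: (clinear_comp (clinear_coord ord0 s) (zl i)).
Qed.

Lemma smooth_trunc V (D : set V) K (z : V -> jets) : open D ->
  (forall j, (j <= K)%N -> smooth_on D (fun p => z p j)) -> smooth_on D (fun p => trunc K (z p)).
Proof.
move=> oD sz; apply: smooth_mx => // i s.
have -> : (fun p => trunc K (z p) i s) = fun p => z p i ord0 s by apply/funext => p; rewrite mxE.
by apply: (smooth_clinear_comp oD (clinear_coord ord0 s)); apply: sz; rewrite -ltnS.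
Qed.

(** Sequences carry no norm here, so calculus takes place on a matrix representative [F]. The
    parameter h is kept as an argument of [F] to allow Taylor expansion uniformly in the jet. *)
Definition jet_smooth W K (J : R -> jets -> W) : Prop :=
  exists2 F : R * 'M[R]_(K.+1, n) -> W, smooth_on (jet_dom K) F &
    forall h z, Q (z 0%N) -> J h z = F (h, trunc K z).

Lemma jet_smooth_ext W K (J J' : R -> jets -> W) :
  (forall h z, Q (z 0%N) -> J h z = J' h z) -> jet_smooth K J -> jet_smooth K J'.
Proof. by move=> JJ [F sF FE]; exists F => // h z Qz; rewrite -JJ// FE. Qed.

Lemma jet_smoothD W K (J J' : R -> jets -> W) :
  jet_smooth K J -> jet_smooth K J' -> jet_smooth K (fun h z => J h z + J' h z).
Proof.
move=> [F sF FE] [F' sF' FE']; exists (fun p => F p + F' p).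
  by apply: smoothD => //; exact: open_jet_dom.
by move=> h z Qz; rewrite FE// FE'.
Qed.

Lemma jet_smooth_sum W K (I : Type) (s : seq I) (J : I -> R -> jets -> W) :
  (forall i, jet_smooth K (J i)) -> jet_smooth K (fun h z => \sum_(i <- s) J i h z).
Proof.
move=> sJ; elim: s => [|i s IH].
  exists (fun=> 0); first exact: smooth_cst.
  by move=> h z _; rewrite big_nil.
apply: jet_smooth_ext (jet_smoothD (sJ i) IH) => h z _.
by rewrite big_cons.
Qed.

Lemma smooth_pow (V : normedModType R) (D : set V) (f : V -> R) i : open D ->
  smooth_on D f -> smooth_on D (fun p => f p ^+ i).
Proof.
move=> oD sf; elim: i => [|i IH]; first exact: smooth_cst.
have -> : (fun p => f p ^+ i.+1) = fun p => f p *: (f p ^+ i : R).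
  by apply/funext => p; rewrite exprS.
by apply: smoothZ => //; exact: finite_dim_R.
Qed.

Lemma jet_smooth_pow W K i (J : R -> jets -> W) : finite_dim W ->
  jet_smooth K J -> jet_smooth K (fun h z => h ^+ i *: J h z).
Proof.
move=> fW [F sF FE]; exists (fun p => p.1 ^+ i *: F p); last by move=> h z Qz; rewrite FE.
apply: smoothZ => //; first exact: open_jet_dom.
apply: smooth_pow; first exact: open_jet_dom.
exact/smooth_clinear/clinear_fst.
Qed.

Lemma jet_smooth_proj K j : (j <= K)%N -> jet_smooth K (fun _ z => z j).
Proof.
move=> jK; exists (fun p => row (inord j) p.2).
  by apply/smooth_clinear/(clinear_comp (clinear_row _) (clinear_snd _ _)).
by move=> h z _; rewrite row_trunc inordK.
Qed.

Lemma jet_smooth_comp W K K' (J : R -> jets -> W) (zeta : nat -> R -> jets -> 'rV[R]_n) :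
  finite_dim W -> jet_smooth K J ->
  (forall j, (j <= K)%N -> jet_smooth K' (zeta j)) ->
  (forall h z, Q (z 0%N) -> Q (zeta 0%N h z)) ->
  jet_smooth K' (fun h z => J h (fun j => zeta j h z)).
Proof.
move=> fW [F sF FE] sz Qz.
pose z_ (p : R * 'M[R]_(K'.+1, n)) : jets := fun j => zeta j p.1 (extend p.2).
exists (fun p => F (p.1, trunc K (z_ p))); last first.
  move=> h z Qz0; rewrite FE; last exact: Qz.
  congr (F (_, _)); apply/matrixP => i s; rewrite !mxE /z_ /=.
  have [G _ GE] := sz i (ltn_ord i).
  by rewrite !GE ?trunc_extend// extend0 row_trunc.
apply: (@smooth_comp _ _ _ _ (open_jet_dom K) _ (jet_dom K') F (fun p => (p.1, trunc K (z_ p)))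
  (open_jet_dom K') (finite_dim_R_mx _ _) fW _ sF).
  by move=> p Dp; apply: jet_dom_trunc; apply: Qz; rewrite extend0.
apply: smooth_pair; [exact: open_jet_dom|exact/smooth_clinear/clinear_fst|].
apply: smooth_trunc; first exact: open_jet_dom.
move=> j /sz[G sG GE]; apply: smooth_ext sG; first exact: open_jet_dom.
by move=> [h p] Dp; rewrite /z_ /= GE ?trunc_extend// extend0.
Qed.

Lemma jet_smoothW W K K' (J : R -> jets -> W) : finite_dim W -> (K <= K')%N ->
  jet_smooth K J -> jet_smooth K' J.
Proof.
move=> fW KK sJ.
apply: (@jet_smooth_comp _ K K' J (fun j _ z => z j)) => // j jK.
exact/jet_smooth_proj/(leq_trans jK).
Qed.

Lemma jet_smooth_common W (J : nat -> R -> jets -> W) N : finite_dim W ->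
  (forall j, (j <= N)%N -> exists K, jet_smooth K (J j)) ->
  exists K, forall j, (j <= N)%N -> jet_smooth K (J j).
Proof.
move=> fW; elim: N => [|N IH] sJ.
  by have [K sK] := sJ 0%N isT; exists K => j; rewrite leqn0 => /eqP ->.
have [|K sK] := IH; first by move=> j jN; apply: sJ; exact: leqW.
have [K' sK'] := sJ N.+1 (leqnn _).
exists (maxn K K') => j; rewrite leq_eqVlt => /predU1P[->|jN].
  exact: jet_smoothW (leq_maxr _ _) sK'.
exact: jet_smoothW (leq_maxl _ _) (sK _ jN).
Qed.

(** Since [Q] is open, the line through [z] in the direction of the shifted jet stays over [Q] for
    small t, where [F] represents [J]; the total derivative is thus a directional derivative of
    [F]. *)
Lemma total_derivE W K (J : (nat -> 'rV[R]_n) -> W) (F : R * 'M[R]_(K.+1, n) -> W) h z :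
  smooth_on (jet_dom K) F -> (forall z, Q (z 0%N) -> J z = F (h, trunc K z)) -> Q (z 0%N) ->
  total_deriv J z = 'D_((0, trunc K (fun j => z j.+1)) : R * 'M[R]_(K.+1, n)) F (h, trunc K z).
Proof.
move=> sF FE Qz; rewrite /total_deriv derive1E.
set v := (0, _) : R * _; set a := (h, _).
have line (t : R) : (h, trunc K (fun j => z j + t *: z j.+1)) = a + t *: v.
  apply: injective_projections => /=; first by rewrite scaler0 addr0.
  by apply/matrixP => i s; rewrite !mxE.
have a0 : a + 0 *: v = a by rewrite scale0r addr0.
have df : differentiable F (a + 0 *: v).
  by rewrite a0; apply: smooth_differentiable sF _; exact: jet_dom_trunc.
have dl := is_derive_line df; rewrite -[in RHS]a0 -(@derive_val _ _ _ _ _ _ _ dl).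
apply: near_eq_derive.
have cz : {for (0 : R), continuous (fun t : R => z 0%N + t *: z 1%N)}.
  exact: (cvgD (cvg_cst (z 0%N)) ((clinear_scalel (z 1%N)).2 0)).
have Q0 : nbhs (z 0%N + (0 : R) *: z 1%N) Q by rewrite scale0r addr0; exact: open_nbhs_nbhs.
have Qt : \forall t \near (0 : R), Q (z 0%N + t *: z 1%N) by exact: (cz _ Q0).
by apply: filterS Qt => t Qt; rewrite FE// line.
Qed.

Lemma jet_smooth_total_deriv W K (J : R -> jets -> W) : finite_dim W ->
  jet_smooth K J -> jet_smooth K.+1 (fun h => total_deriv (J h)).
Proof.
move=> fW [F sF FE].
have [I [b [c [cl cE]]]] := @finite_dim_R_mx R K.+1 n.
(* A jet of order [K.+1] contains both the [K]-jet at which [F] is differentiated ([lo]) and the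
   shifted [K]-jet that gives the direction ([sh]). *)
pose lo (p : 'M[R]_(K.+2, n)) := trunc K (extend p).
pose sh (p : 'M[R]_(K.+2, n)) := trunc K (fun j => extend p j.+1).
have lol : clinear lo by apply: clinear_trunc => j; exact: clinear_extend.
have shl : clinear sh by apply: clinear_trunc => j; exact: clinear_extend.
have loE z : lo (trunc K.+1 z) = trunc K z.
  apply/matrixP => i s; rewrite !mxE /extend (ltnW (ltn_ord i)).
  by rewrite !mxE inordK// ltnS ltnW.
have shE z : sh (trunc K.+1 z) = trunc K (fun j => z j.+1).
  by apply/matrixP => i s; rewrite !mxE /extend ltn_ord !mxE inordK// ltnS.
exists (fun p => \sum_i c i (0, sh p.2) *: 'D_(b i) F (p.1, lo p.2)).
  apply: smooth_sum => [|i]; first exact: open_jet_dom.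
  apply: smoothZ => //; first exact: open_jet_dom.
    apply/smooth_clinear/(clinear_comp (cl i)).
    apply: (clinear_comp (clinear_inr _ _)).
    exact: (clinear_comp shl (clinear_snd _ _)).
  apply: (@smooth_comp _ _ _ _ (open_jet_dom K) _ (jet_dom K.+1) _ (fun p => (p.1, lo p.2))
    (open_jet_dom K.+1) (finite_dim_R_mx _ _) fW _ (smooth_derive (b i) sF)).
    by move=> p Dp; apply: jet_dom_trunc; rewrite extend0.
  apply: smooth_pair; [exact: open_jet_dom|exact/smooth_clinear/clinear_fst|].
  exact/smooth_clinear/(clinear_comp lol (clinear_snd _ _)).
move=> h z Qz; rewrite (total_derivE sF (FE h) Qz) /= loE shE.
have df : differentiable F (h, trunc K z).
  by apply: smooth_differentiable sF _; exact: jet_dom_trunc.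
rewrite deriveE// [X in 'd _ _ X]cE linear_sum.
by apply: eq_bigr => i _; rewrite linearZ/= -deriveE.
Qed.

Lemma derive1n_jet W K (J : R -> jets -> W) (F : R * 'M[R]_(K.+1, n) -> W) i z :
  (forall h z, Q (z 0%N) -> J h z = F (h, trunc K z)) -> Q (z 0%N) ->
  derive1n i (fun h => J h z) 0 = iter i (@dh R _ W) F (0, trunc K z).
Proof.
move=> FE Qz; have -> : (fun h => J h z) = fun h => F (h, trunc K z).
  by apply/funext => h; rewrite FE.
by rewrite derive1n_dh.
Qed.

Lemma jet_smooth_derive1n W K (J : R -> jets -> W) i : finite_dim W ->
  jet_smooth K J -> jet_smooth K (fun _ z => derive1n i (fun h => J h z) 0).
Proof.
move=> fW [F sF FE]; exists (fun p => iter i (@dh R _ W) F (0, p.2)); last first.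
  by move=> h z Qz; rewrite (derive1n_jet i FE Qz).
apply: (@smooth_comp _ _ _ _ (open_jet_dom K) _ (jet_dom K) _ (fun p => (0, p.2))
  (open_jet_dom K) (finite_dim_R_mx _ _) fW _ (smooth_iter_derive _ i sF)) => //.
apply: smooth_clinear; exact: (clinear_comp (clinear_inr _ _) (clinear_snd _ _)).
Qed.

End JetFunctions.
Arguments jet_dom {R n} Q K _.
Arguments open_jet_dom {R n Q} Q_open K.

(** * Smooth families of jets and prolongations of curves *)

Section JetFamilies.
Context {R : realType} {n : nat} (Q : set 'rV[R]_n) (Q_open : open Q).
Context (D : set (R * R)) (D_open : open D).
Implicit Types W : normedModType R.

Let jets := nat -> 'rV[R]_n.

Definition jet_family (zeta : R * R -> jets) : Prop :=
  (forall j, smooth_on D (fun p => zeta p j)) /\ forall p, D p -> Q (zeta p 0%N).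

Lemma smooth_family_trunc K zeta : jet_family zeta ->
  smooth_on D (fun p => (p.1, trunc K (zeta p))).
Proof.
move=> [sz _]; apply: smooth_pair => //; first exact/smooth_clinear/clinear_fst.
by apply: smooth_trunc.
Qed.

Lemma continuous_family_trunc K zeta p : jet_family zeta -> D p ->
  {for p, continuous (fun p => (p.1, trunc K (zeta p)))}.
Proof.
move=> jz Dp; apply: differentiable_continuous.
exact: (smooth_differentiable (smooth_family_trunc K jz) Dp).
Qed.

Lemma smooth_jet_family W K (J : R -> jets -> W) zeta : finite_dim W ->
  jet_smooth Q K J -> jet_family zeta -> smooth_on D (fun p => J p.1 (zeta p)).
Proof.
move=> fW [F sF FE] jz.
pose u (p : R * R) := (p.1, trunc K (zeta p)) : R * 'M[R]_(K.+1, n).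
apply: (@smooth_ext _ _ _ _ D_open (F \o u)).
  by move=> p Dp /=; rewrite FE//; exact: jz.2.
apply: (@smooth_comp _ _ _ _ (open_jet_dom Q_open K) _ D F u D_open (finite_dim_R_mx _ _) fW _ sF).
  by move=> p Dp; apply: jet_dom_trunc; exact: jz.2.
exact: smooth_family_trunc.
Qed.

Lemma near_D x : D (0, x) -> \forall p \near ((0, x) : R * R), D p.
Proof. by move=> Dx; exact: open_nbhs_nbhs. Qed.

Lemma jet_smooth_Oloc W K (J : R -> jets -> W) zeta zeta' r x : finite_dim W ->
  jet_smooth Q K J -> jet_family zeta -> jet_family zeta' -> D (0, x) ->
  (forall j, (j <= K)%N -> Oloc r x (fun p => zeta p j - zeta' p j)) ->
  Oloc r x (fun p => J p.1 (zeta p) - J p.1 (zeta' p)).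
Proof.
move=> fW [F sF FE] jz jz' Dx Oz.
pose u zeta (p : R * R) := (p.1, trunc K (zeta p)) : R * 'M[R]_(K.+1, n).
apply: (@Oloc_ext _ _ _ _ _ (fun p => F (u zeta p) - F (u zeta' p))).
  by apply: filterS (near_D Dx) => p Dp; rewrite !FE//; [exact: jz'.2|exact: jz.2].
have inQ zeta0 : jet_family zeta0 -> jet_dom Q K (u zeta0 (0, x)).
  by move=> jz0; apply: jet_dom_trunc; exact: jz0.2.
apply: (@Oloc_smooth_comp _ _ _ _ _ F (u zeta) (u zeta') r x (finite_dim_R_mx _ _) fW
  (open_jet_dom Q_open K) sF) => //.
- exact: inQ.
- exact: inQ.
- exact: (continuous_family_trunc jz Dx).
- exact: (continuous_family_trunc jz' Dx).
apply: (@Oloc_ext _ _ _ _ _ (fun p => (0, trunc K (zeta p) - trunc K (zeta' p)) : R * _)).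
  by apply: filterE => p; apply: injective_projections; rewrite /= ?subrr.
apply: (Oloc_clinear (clinear_inr _ _)); apply: Oloc_mx => i s.
apply: Oloc_ext (Oloc_clinear (clinear_coord ord0 s) (Oz i (ltn_ord i))).
by apply: filterE => p; rewrite /= !mxE.
Qed.

(** In J(h, zeta(h, x)) only the explicit h is expanded, with the jet frozen. The remainder is
    uniform near a given jet, so the jet may afterwards be allowed to move with h and x. *)
Lemma jet_taylor_Oloc W K (J : R -> jets -> W) zeta r x : finite_dim W ->
  jet_smooth Q K J -> jet_family zeta -> D (0, x) ->
  Oloc r x (fun p => J p.1 (zeta p) -
    \sum_(i < r) p.1 ^+ i *: ((i`!%:R)^-1 *: derive1n i (fun h => J h (zeta p)) 0)).
Proof.
move=> fW [F sF FE] jz Dx.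
have D0 : jet_dom Q K (0, trunc K (zeta (0, x))) by apply: jet_dom_trunc; exact: jz.2.
have OF := taylor_Oloc r fW (open_jet_dom Q_open K) sF D0.
have su := smooth_trunc (K := K) D_open (fun j _ => jz.1 j).
have cu := differentiable_continuous (smooth_differentiable su Dx).
apply: Oloc_ext (Oloc_comp cu erefl OF).
apply: filterS (near_D Dx) => p Dp; rewrite FE; last exact: jz.2.
congr (_ - _); rewrite /taylor; apply: eq_bigr => i _; congr (_ *: (_ *: _)).
by rewrite (derive1n_jet i FE)//; exact: jz.2.
Qed.

Section Prolongation.
Context (g : R -> R -> 'rV[R]_n).
Let G (p : R * R) := g p.1 p.2.
Hypothesis g_smooth : smooth_on D G.
Hypothesis g_Q : forall p, D p -> Q (G p).

Lemma prolong_dx j p : prolong (g p.1) p.2 j = iter j (@dx R _) G p.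
Proof. by case: p => h x; exact: (congr1 (fun f => f x) (derive1n_dx G j h)). Qed.

Lemma smooth_iter_dx j : smooth_on D (iter j (@dx R _) G).
Proof. exact: smooth_iter_derive. Qed.

Lemma jet_family_prolong : jet_family (fun p => prolong (g p.1) p.2).
Proof.
split=> [j|p Dp]; last exact: g_Q.
apply: smooth_ext (smooth_iter_dx j) => // p _; exact/esym/prolong_dx.
Qed.

(** The x-derivative of entry [j] of a prolongation is its entry [j.+1], so the chain rule produces
    exactly the direction used by [total_deriv]. *)
Lemma total_deriv_prolong W K (J : R -> jets -> W) p : finite_dim W -> jet_smooth Q K J -> D p ->
  total_deriv (J p.1) (prolong (g p.1) p.2) = dx (fun p => J p.1 (prolong (g p.1) p.2)) p.
Proof.
move=> fW [F sF FE] Dp; have jp := jet_family_prolong.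
pose u (p : R * R) := (p.1, trunc K (prolong (g p.1) p.2)) : R * 'M[R]_(K.+1, n).
have su : smooth_on D u := smooth_family_trunc K jp.
have du := smooth_differentiable su Dp.
rewrite (total_derivE Q_open sF (FE p.1)); last exact: jp.2.
have Du : 'D_((0, 1) : R * R) u p = (0, trunc K (fun j => prolong (g p.1) p.2 j.+1)).
  apply: injective_projections.
    rewrite -(derive_clinear_comp _ (clinear_fst _ _) du).
    by rewrite (clinear_derive _ _ (clinear_fst R R)).
  apply/matrixP => i s.
  have cl : clinear ((fun M : 'M[R]_(K.+1, n) => M i s) \o snd : R * 'M[R]_(K.+1, n) -> R).
    exact: clinear_comp (clinear_coord i s) (clinear_snd _ _).
  have Eu : ((fun M : 'M[R]_(K.+1, n) => M i s) \o snd) \o u =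
      (fun M : 'rV[R]_n => M ord0 s) \o iter i (@dx R _) G.
    by apply/funext => q; rewrite /= mxE prolong_dx.
  have dG := smooth_differentiable (smooth_iter_dx i) Dp.
  have := derive_clinear_comp ((0, 1) : R * R) cl du.
  rewrite Eu (derive_clinear_comp _ (clinear_coord ord0 s) dG) => /= <-.
  by rewrite mxE; exact: (congr1 (fun M : 'rV[R]_n => M ord0 s) (esym (prolong_dx i.+1 p))).
have Fp : differentiable F (u p).
  by apply: smooth_differentiable sF _; apply: jet_dom_trunc; exact: jp.2.
have := derive_comp ((0, 1) : R * R) du Fp; rewrite Du => <-.
apply: near_eq_derive; apply: filterS (open_nbhs_nbhs (conj D_open Dp)) => q Dq.
by rewrite FE//; exact: jp.2.
Qed.

(** This is differentiation of an approximate equation in xi: [Oloc_dx] preserves the order, and on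
    a prolongation the x-derivative of [J] is its total derivative. *)
Lemma Oloc_prolong_derive K (J : R -> jets -> 'rV[R]_n) (j r : nat) :
  finite_dim 'rV[R]_n -> jet_smooth Q K J ->
  (forall x, D (0, x) ->
    Oloc r x (fun p => prolong (g p.1) p.2 j - J p.1 (prolong (g p.1) p.2))) ->
  forall x, D (0, x) ->
    Oloc r x (fun p => prolong (g p.1) p.2 j.+1 - total_deriv (J p.1) (prolong (g p.1) p.2)).
Proof.
move=> fr sJ OJ x Dx; have jz := jet_family_prolong.
have sz := smooth_jet_family fr sJ jz.
apply: Oloc_ext (Oloc_dx D_open fr (smoothB D_open (jz.1 j) sz) OJ Dx).
apply: filterS (near_D Dx) => p Dp.
have E1 : dx (fun p => prolong (g p.1) p.2 j) p = prolong (g p.1) p.2 j.+1.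
  by rewrite prolong_dx iterS; congr (dx _ p); apply/funext => q; rewrite prolong_dx.
rewrite (total_deriv_prolong fr sJ Dp) -E1.
exact: (dxB (smooth_differentiable (jz.1 j) Dp) (smooth_differentiable sz Dp)).
Qed.

End Prolongation.

End JetFamilies.

Lemma open_jet_space (R : realType) (n K : nat) (Q : set 'rV[R]_n) :
  open Q -> open (jet_space K Q : set 'M[R]_(K.+1, n)).
Proof.
move=> oQ; have rc : continuous (fun p : 'M[R]_(K.+1, n) => row ord0 p).
  exact: (clinear_row ord0).2.
exact: open_comp (fun p _ => rc p) oQ.
Qed.

(** * Jet functions of unspecified finite order *)

Section FiniteOrder.
Context {R : realType} {n : nat} (Q : set 'rV[R]_n) (Q_open : open Q).
Implicit Types W : normedModType R.

Let jets := nat -> 'rV[R]_n.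

Definition finite_order W (J : R -> jets -> W) : Prop := exists K, jet_smooth Q K J.

Lemma jet_smooth_coef W K (f : 'M[R]_(K.+1, n) -> W) : finite_dim W ->
  smooth_on (jet_space K Q) f -> jet_smooth Q K (fun _ z => f (trunc K z)).
Proof.
move=> fW sf; exists (f \o snd) => //.
have oJ := open_jet_space (K := K) Q_open.
apply: (@smooth_comp _ _ _ _ oJ _ (jet_dom Q K) f snd (open_jet_dom Q_open K)
  (@finite_dim_mx R _ _) fW _ sf) => //.
exact/smooth_clinear/clinear_snd.
Qed.

(** Smoothness is asked up to index [N] only, because [reduces_to] constrains [a_tilde] only
    there. *)
Lemma jet_smooth_series W K N (f : nat -> 'M[R]_(K.+1, n) -> W) : finite_dim W ->
  (forall i, (i <= N)%N -> smooth_on (jet_space K Q) (f i)) ->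
  jet_smooth Q K (series_upto N (m := fun=> K) f).
Proof.
move=> fW sf; apply: jet_smooth_sum => // i; apply: jet_smooth_pow => //.
by apply: jet_smooth_coef => //; apply: sf; rewrite -ltnS.
Qed.

Lemma finite_order_sum_pow W N (J : nat -> R -> jets -> W) : finite_dim W ->
  (forall i, finite_order (J i)) -> finite_order (fun h z => \sum_(i < N.+1) h ^+ i *: J i h z).
Proof.
move=> fW fJ; have [K sK] := jet_smooth_common Q_open fW (fun i (_ : (i <= N)%N) => fJ i).
exists K; apply: jet_smooth_sum => // i; apply: jet_smooth_pow => //.
by apply: sK; rewrite -ltnS.
Qed.

Lemma finite_order_series W N (k : nat -> nat) (f : forall i, 'M[R]_((k i).+1, n) -> W) :
  finite_dim W -> (forall i, smooth_on (jet_space (k i) Q) (f i)) ->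
  finite_order (series_upto N f).
Proof.
move=> fW sf; apply: (finite_order_sum_pow N (J := fun i _ z => f i (trunc (k i) z)) fW) => i.
by exists (k i); exact: jet_smooth_coef.
Qed.

Lemma finite_order_comp W (J : R -> jets -> W) (zeta : nat -> R -> jets -> 'rV[R]_n) :
  finite_dim W -> finite_order J -> (forall j, finite_order (zeta j)) ->
  (forall h z, Q (z 0%N) -> Q (zeta 0%N h z)) ->
  finite_order (fun h z => J h (fun j => zeta j h z)).
Proof.
move=> fW [K sJ] fz Qz.
have [K' sK'] := jet_smooth_common Q_open (@finite_dim_mx R 1 n)
  (fun j (_ : (j <= K)%N) => fz j).
by exists K'; exact: (jet_smooth_comp Q_open fW sJ sK' Qz).
Qed.

End FiniteOrder.

(** * From (R) back to (T) *)

Section Reduction.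
Context {R : realType} {n : nat} (Q : set 'rV[R]_n) (Q_open : open Q).
Context (m : nat -> nat) (a : forall i, 'M[R]_((m i).+1, n) -> 'rV[R]_n).
Arguments a : clear implicits.
Hypothesis a_smooth : forall i, smooth_on (jet_space (m i) Q) (a i).
Variable N : nat.

Let jets := nat -> 'rV[R]_n.
Let fr : finite_dim 'rV[R]_n := @finite_dim_mx R 1 n.

Lemma finite_order_iter_total_deriv l :
  finite_order Q (fun h => iter l (@total_deriv R n 'rV[R]_n) (series_upto N a h)).
Proof.
elim: l => [|l [K IH]]; first exact: finite_order_series.
by exists K.+1; exact: (jet_smooth_total_deriv Q_open fr IH).
Qed.

Lemma finite_order_substitute j : finite_order Q (fun h z => substitute N a h z j).
Proof.
rewrite /substitute; case: (j < 2)%N; last exact: finite_order_iter_total_deriv.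
by exists j; exact: jet_smooth_proj.
Qed.

Lemma substitute_eq h z j : (j < 2)%N -> substitute N a h z j = z j.
Proof. by move=> j2; rewrite /substitute j2. Qed.

Lemma iter_substitute_eq s h z j : (j < 2)%N -> iter s (substitute N a h) z j = z j.
Proof. by move=> j2; elim: s => [|s IH] //=; rewrite substitute_eq. Qed.

Lemma finite_order_substitution_step (c : nat -> jets -> 'rV[R]_n) :
  (forall i, finite_order Q (fun=> c i)) ->
  forall i, finite_order Q (fun=> substitution_step N a c i).
Proof.
move=> fc i.
have [K sK] : finite_order Q
    (fun h z => \sum_(k < N.+1) h ^+ k *: c k (substitute N a h z)).
  apply: (finite_order_sum_pow Q_open N (J := fun k h z => c k (substitute N a h z)) fr) => k.
  apply: (finite_order_comp Q_open (J := fun=> c k) fr (fc k) finite_order_substitute).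
  by move=> h z Qz; rewrite substitute_eq.
exists K; have [F sF FE] := jet_smooth_derive1n Q_open i fr sK.
exists (fun p => (i`!%:R)^-1 *: F p); last by move=> h z Qz; rewrite -(FE h).
apply: smoothZ => //; first exact: open_jet_dom.
exact: smooth_cst.
Qed.

Definition reduction_round s := iter s (substitution_step N a) (fun k y => a k (trunc (m k) y)).

Lemma finite_order_reduction_round s i : finite_order Q (fun=> reduction_round s i).
Proof.
elim: s i => [|s IH] i; last exact: finite_order_substitution_step.
by exists (m i); exact: jet_smooth_coef.
Qed.

Section OnFamilies.
Context (D : set (R * R)) (D_open : open D).

Lemma jet_family_substitute zeta : jet_family Q D zeta ->
  jet_family Q D (fun p => substitute N a p.1 (zeta p)).
Proof.
move=> jz; split=> [j|p Dp]; last by rewrite substitute_eq//; exact: jz.2.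
have [K sK] := finite_order_substitute j.
exact: (smooth_jet_family Q_open D_open fr sK jz).
Qed.

Lemma jet_family_iter_substitute s zeta : jet_family Q D zeta ->
  jet_family Q D (fun p => iter s (substitute N a p.1) (zeta p)).
Proof. by move=> jz; elim: s => [//|s IH]; exact: jet_family_substitute. Qed.

(** One more round replaces the sum evaluated at the substituted family by its Taylor polynomial in
    h, at the cost of O(h^(N+1)). The induction hypothesis is then used at the substituted family,
    hence the quantification over all families. *)
Lemma reduction_round_Oloc s zeta x : jet_family Q D zeta -> D (0, x) ->
  Oloc N.+1 x (fun p => \sum_(i < N.+1) p.1 ^+ i *: reduction_round s i (zeta p) -
    series_upto N a p.1 (iter s (substitute N a p.1) (zeta p))).
Proof.
move=> + Dx; elim: s zeta => [|s IH] zeta jz.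
  by apply: Oloc_ext (Oloc0 x _ _); apply: filterE => p; rewrite /series_upto subrr.
have fc := finite_order_reduction_round s.
have [K sK] : finite_order Q
    (fun h z => \sum_(k < N.+1) h ^+ k *: reduction_round s k (substitute N a h z)).
  apply: (finite_order_sum_pow Q_open N
    (J := fun k h z => reduction_round s k (substitute N a h z)) fr) => k.
  apply: (finite_order_comp Q_open (J := fun=> reduction_round s k) fr (fc k)
    finite_order_substitute).
  by move=> h z Qz; rewrite substitute_eq.
have OT := jet_taylor_Oloc Q_open D_open N.+1 fr sK jz Dx.
apply: Oloc_ext (Oloc_trans (Oloc_subC OT) (IH _ (jet_family_substitute jz))).
by apply: filterE => p; rewrite -iterSr.
Qed.

Hypothesis m0 : m 0%N = 1%N.

(** By [m0] the term of index 0 reads only the entries 0 and 1, where the families agree, so it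
    cancels; every other term carries a factor h. *)
Lemma series_Oloc zeta zeta' r x : jet_family Q D zeta -> jet_family Q D zeta' -> D (0, x) ->
  (forall p j, (j < 2)%N -> zeta p j = zeta' p j) ->
  (forall j, Oloc r x (fun p => zeta p j - zeta' p j)) ->
  Oloc r.+1 x (fun p => series_upto N a p.1 (zeta p) - series_upto N a p.1 (zeta' p)).
Proof.
move=> jz jz' Dx zz Oz.
apply: (@Oloc_ext _ _ _ _ _ (fun p => \sum_(i < N.+1)
    p.1 ^+ i *: (a i (trunc (m i) (zeta p)) - a i (trunc (m i) (zeta' p))))).
  apply: filterE => p; rewrite /series_upto -sumrB; apply: eq_bigr => i _.
  by rewrite scalerBr.
apply: Oloc_sum => -[[|i] iN] _ /=.
  apply: Oloc_ext (Oloc0 x _ _); apply: filterE => p.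
  suff -> : trunc (m 0%N) (zeta p) = trunc (m 0%N) (zeta' p) by rewrite subrr scaler0.
  apply/matrixP => j s; rewrite !mxE zz//.
  by apply: leq_trans (ltn_ord j) _; rewrite m0.
apply: (OlocW (r := i.+1 + r)); first by rewrite addSn ltnS leq_addl.
apply: Oloc_pow.
have sa := jet_smooth_coef Q_open fr (a_smooth (i := i.+1)).
exact: (jet_smooth_Oloc Q_open D_open fr sa jz jz' Dx).
Qed.

Section Solutions.
Context (g : R -> R -> 'rV[R]_n).
Hypothesis g_smooth : smooth_on D (fun p : R * R => g p.1 p.2).
Hypothesis g_Q : forall p, D p -> Q (g p.1 p.2).
Let zeta (p : R * R) := prolong (g p.1) p.2.

Let jz : jet_family Q D zeta.
Proof. exact: jet_family_prolong. Qed.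

(** Differentiating the equation for entry 2 repeatedly yields one for every entry [l.+2], so one
    substitution moves a prolongation by O(h^r). For further rounds, substitution is a smooth map
    and carries the estimate from S^s z, z to S^(s+1) z, S z. *)
Lemma Oloc_prolong_substitute r :
  (forall x, D (0, x) -> Oloc r x (fun p => zeta p 2%N - series_upto N a p.1 (zeta p))) ->
  forall s j x, D (0, x) ->
    Oloc r x (fun p => iter s (substitute N a p.1) (zeta p) j - zeta p j).
Proof.
move=> Or.
have O2 l : forall x, D (0, x) -> Oloc r x (fun p => zeta p l.+2 -
    iter l (@total_deriv R n 'rV[R]_n) (series_upto N a p.1) (zeta p)).
  elim: l => [//|l IH].
  have [K sK] := finite_order_iter_total_deriv l.
  exact: (Oloc_prolong_derive Q_open D_open g_smooth g_Q fr sK IH).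
have O1 j x : D (0, x) -> Oloc r x (fun p => substitute N a p.1 (zeta p) j - zeta p j).
  move=> Dx; case: j => [|[|l]].
  - by apply: Oloc_ext (Oloc0 x _ _); apply: filterE => p; rewrite subrr.
  - by apply: Oloc_ext (Oloc0 x _ _); apply: filterE => p; rewrite subrr.
  - apply: Oloc_ext (Oloc_subC (O2 l x Dx)); apply: filterE => p.
    by rewrite /substitute /= !subSS subn0.
elim=> [|s IH] j x Dx.
  by apply: Oloc_ext (Oloc0 x _ _); apply: filterE => p; rewrite subrr.
apply: Oloc_trans (O1 j x Dx).
have [K sK] := finite_order_substitute j.
apply: (jet_smooth_Oloc Q_open D_open fr sK (jet_family_iter_substitute s jz) jz Dx) => l _.
exact: IH.
Qed.

Context (a_tilde : nat -> 'M[R]_(2, n) -> 'rV[R]_n) (s : nat).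
Hypothesis a_tildeE : forall i z, (i <= N)%N -> Q (z 0%N) ->
  reduction_round s i z = a_tilde i (trunc 1 z).
Hypothesis g_solves : forall x, D (0, x) -> Oloc N.+1 x (fun p =>
  zeta p 2%N - series_upto N (m := fun=> 1%N) a_tilde p.1 (zeta p)).

(* [a 0] only sees the 1-jet, so each step of the induction on [r] gains a power of [h]. *)
Lemma solves_of_reduced r x : (r <= N.+1)%N -> D (0, x) ->
  Oloc r x (fun p => zeta p 2%N - series_upto N a p.1 (zeta p)).
Proof.
elim: r x => [|r IH] x rN Dx.
  (* Order 0 asks for local boundedness only, which continuity gives. *)
  have [K sK] := finite_order_iter_total_deriv 0.
  apply: Oloc_continuous; apply: (@differentiable_continuous _ _ _ _
    (fun p => zeta p 2%N - series_upto N a p.1 (zeta p))).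
  apply: smooth_differentiable Dx; apply: smoothB => //; first exact: jz.1.
  exact: (smooth_jet_family Q_open D_open fr sK jz).
have {}IH y : D (0, y) -> Oloc r y (fun p => zeta p 2%N - series_upto N a p.1 (zeta p)).
  by apply: IH; exact: ltnW.
have js := jet_family_iter_substitute s jz.
apply: (Oloc_trans (v := fun p => series_upto N a p.1 (iter s (substitute N a p.1) (zeta p)))).
  apply: (Oloc_trans (v := fun p => series_upto N (m := fun=> 1%N) a_tilde p.1 (zeta p))).
    exact: OlocW rN (g_solves Dx).
  apply: Oloc_ext (OlocW rN (reduction_round_Oloc s jz Dx)).
  apply: filterS (open_nbhs_nbhs (conj D_open Dx)) => p Dp; congr (_ - _).
  apply: eq_bigr => i _; congr (_ *: _); apply: a_tildeE; last exact: jz.2.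
  by rewrite -ltnS.
apply: series_Oloc => //.
  by move=> p j j2; rewrite iter_substitute_eq.
by move=> j; exact: Oloc_prolong_substitute.
Qed.

End Solutions.

End OnFamilies.

End Reduction.

(** * The quantity induced on 1-jets *)

Section SecondOrderJets.
Context {R : realType} {n : nat} (Q : set 'rV[R]_n) (Q_open : open Q).
Context (b : nat -> 'M[R]_(2, n) -> 'rV[R]_n) (N : nat).
Hypothesis b_smooth : forall i, (i <= N)%N -> smooth_on (jet_space 1 Q) (b i).

Let jets := nat -> 'rV[R]_n.
Let fr : finite_dim 'rV[R]_n := @finite_dim_mx R 1 n.

(** The zeros beyond index 2 are never read: the total derivative of a function of the 1-jet sees
    the 2-jet only. *)
Definition two_jet (h : R) (z : jets) : jets :=
  fun l => match l with
           | 0 => z 0%N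
           | 1 => z 1%N
           | 2 => series_upto N (m := fun=> 1%N) b h z
           | _ => 0
           end.

(* The j-th derivative of a solution of [phi'' = b_0 + h b_1 + ...] as a function of its 1-jet. *)
Fixpoint second_order_jet (j : nat) (h : R) (z : jets) : 'rV[R]_n :=
  if j is j'.+1 then
    if j' is 0 then z 1%N else total_deriv (second_order_jet j' h) (two_jet h z)
  else z 0%N.

Lemma jet_smooth_two_jet l : jet_smooth Q 1 (fun h z => two_jet h z l).
Proof.
case: l => [|[|[|l]]].
- exact: jet_smooth_proj.
- exact: jet_smooth_proj.
- exact: jet_smooth_series.
- by exists (fun=> 0) => //; exact: smooth_cst.
Qed.

(** The order does not grow with [j]: a total derivative raises it to 2, and inserting [two_jet]
    brings it back to 1. *)
Lemma jet_smooth_second_order_jet j : jet_smooth Q 1 (second_order_jet j).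
Proof.
case: j => [|j]; first exact: (@jet_smooth_proj _ _ Q 1 0).
elim: j => [|j IH]; first exact: (@jet_smooth_proj _ _ Q 1 1).
apply: (jet_smooth_comp Q_open (zeta := fun l h z => two_jet h z l) fr
  (jet_smooth_total_deriv Q_open fr IH)) => //.
by move=> l _; exact: jet_smooth_two_jet.
Qed.

Context (D : set (R * R)) (D_open : open D) (g : R -> R -> 'rV[R]_n).
Hypothesis g_smooth : smooth_on D (fun p : R * R => g p.1 p.2).
Hypothesis g_Q : forall p, D p -> Q (g p.1 p.2).
Let zeta (p : R * R) := prolong (g p.1) p.2.

Let jz : jet_family Q D zeta.
Proof. exact: jet_family_prolong. Qed.

Lemma jet_family_second_order_jet :
  jet_family Q D (fun p j => second_order_jet j p.1 (zeta p)).
Proof.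
split=> [j|p Dp]; last exact: jz.2.
exact: (smooth_jet_family Q_open D_open fr (jet_smooth_second_order_jet j) jz).
Qed.

Lemma jet_family_two_jet : jet_family Q D (fun p => two_jet p.1 (zeta p)).
Proof.
split=> [j|p Dp]; last exact: jz.2.
exact: (smooth_jet_family Q_open D_open fr (jet_smooth_two_jet j) jz).
Qed.

Hypothesis g_solves : forall x, D (0, x) -> Oloc N.+1 x (fun p =>
  zeta p 2%N - series_upto N (m := fun=> 1%N) b p.1 (zeta p)).

(** Differentiating the estimate for one entry expresses the next as a total derivative at the true
    prolongation; (R) then allows its 2-jet to be replaced by [two_jet]. *)
Lemma second_order_jet_Oloc j x : D (0, x) ->
  Oloc N.+1 x (fun p => zeta p j - second_order_jet j p.1 (zeta p)).
Proof.
have O0 j' y : (fun p => zeta p j' - second_order_jet j' p.1 (zeta p)) = (fun=> 0) ->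
    Oloc N.+1 y (fun p => zeta p j' - second_order_jet j' p.1 (zeta p)).
  by move=> ->; exact: Oloc0.
case: j => [|j]; first by move=> _; apply: O0; apply/funext => p; rewrite subrr.
elim: j x => [|j IH] x Dx; first by apply: O0; apply/funext => p; rewrite subrr.
have sG := jet_smooth_second_order_jet j.+1.
apply: Oloc_trans (Oloc_prolong_derive Q_open D_open g_smooth g_Q fr sG IH Dx) _.
apply: (jet_smooth_Oloc Q_open D_open fr (jet_smooth_total_deriv Q_open fr sG)
  jz jet_family_two_jet Dx).
case=> [|[|[|l]]] // _ /=.
- by apply: Oloc_ext (Oloc0 x _ _); apply: filterE => p; rewrite subrr.
- by apply: Oloc_ext (Oloc0 x _ _); apply: filterE => p; rewrite subrr.
- exact: g_solves.
Qed.

End SecondOrderJets.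

(** Used where a coefficient is known only through its values on truncated sequences, such as
    [a_tilde]. Every matrix is the truncation of its padding by 0, so these values determine [f],
    and smoothness is inherited from [c]. *)
Lemma smooth_on_jet_coef (R : realType) (n : nat) (Q : set 'rV[R]_n) (W : normedModType R) K K'
    (c : (nat -> 'rV[R]_n) -> W) (f : 'M[R]_(K.+1, n) -> W) :
  open Q -> finite_dim W -> jet_smooth Q K' (fun=> c) ->
  (forall z, Q (z 0%N) -> c z = f (trunc K z)) -> smooth_on (jet_space K Q) f.
Proof.
move=> Q_open fW [F sF FE] cE.
have oJ := open_jet_space (K := K) Q_open.
pose u (p : 'M[R]_(K.+1, n)) := (0, trunc K' (extend p)) : R * 'M[R]_(K'.+1, n).
apply: (@smooth_ext _ _ _ _ oJ (F \o u)).
  move=> p Qp; have Qe : Q (extend p 0%N) by rewrite extend0.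
  by rewrite /= -(FE 0 _ Qe) cE// trunc_extend.
apply: (@smooth_comp _ _ _ _ (open_jet_dom Q_open K') _ _ F u oJ
  (finite_dim_R_mx _ _) fW _ sF).
  by move=> p Qp; apply: jet_dom_trunc; rewrite extend0.
apply: smooth_clinear; apply: (clinear_comp (clinear_inr _ _)).
by apply: clinear_trunc => j; exact: clinear_extend.
Qed.

Lemma open_family_dom (R : realType) (e al be : R) : open (family_dom e al be).
Proof.
have of1 : open ((fun p : R * R => p.1) @^-1` [set h | `|h| < e]).
  apply: open_comp; first by move=> p _; exact: (clinear_fst R R).2.
  have -> : [set h : R | `|h| < e] = ball (0 : R) e.
    by rewrite -ball_normE /=; apply/seteqP; split=> h /=; rewrite sub0r normrN.
  exact: ball_open.
have of2 : open ((fun p : R * R => p.2) @^-1` [set` `]al, be[]).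
  apply: open_comp; first by move=> p _; exact: (clinear_snd R R).2.
  exact: interval_open.
exact: openI of1 of2.
Qed.

Theorem proposition1 (R : realType) (n : nat) (Q : set 'rV[R]_n)
    (Q_open : open Q)
    (* the formal equation; its coefficient a 0 depends on the 1-jet *)
    (m : nat -> nat) (m0 : m 0%N = 1%N)
    (a : forall i, 'M[R]_((m i).+1, n) -> 'rV[R]_n)
    (a_smooth : forall i, smooth_on (jet_space (m i) Q) (a i))
    (* the formal Lagrangian *)
    (k : nat -> nat) (k0 : k 0%N = 1%N)
    (L : forall i, 'M[R]_((k i).+1, n) -> R)
    (L_smooth : forall i, smooth_on (jet_space (k i) Q) (L i))
    (L_regular : forall p, jet_space (k 0%N) Q p ->
       velocity_hessian (L 0%N) p \in unitmx)
    (a_from_L : arises_from Q a L)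
    (* truncation (T), its reduction (R), and the conserved quantity *)
    (N M : nat) (M_def : M = (\max_(1 <= i < N.+1) m i)%N)
    (a_tilde : nat -> 'M[R]_(2, n) -> 'rV[R]_n)
    (a_red : reduces_to Q N a a_tilde)
    (I : nat -> 'M[R]_(M.+1, n) -> R)
    (I_smooth : forall i, smooth_on (jet_space M Q) (I i))
    (I_conserved : conserved Q N a (k := fun=> M) I) :
  exists Ibar : nat -> 'M[R]_(2, n) -> R,
    [/\ forall i, smooth_on (jet_space 1 Q) (Ibar i),
        conserved Q N (m := fun=> 1%N) a_tilde (k := fun=> 1%N) Ibar &
        forall (e al be : R) (g : R -> R -> 'rV[R]_n),
          curve_family Q e al be g -> solves N (m := fun=> 1%N) a_tilde al be g ->
          Oh_next N al be (fun h x =>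
            series_upto N (m := fun=> 1%N) Ibar h (prolong (g h) x)
            - series_upto N (m := fun=> M) I h (prolong (g h) x))].
Proof.
have fr := @finite_dim_mx R 1 n; have f1 := @finite_dim_R R.
have [s a_tildeE] := a_red.
have b_smooth i : (i <= N)%N -> smooth_on (jet_space 1 Q) (a_tilde i).
  move=> iN; have [K sK] := finite_order_reduction_round Q_open a_smooth N s i.
  exact: (smooth_on_jet_coef Q_open fr sK (fun z Qz => a_tildeE i z iN Qz)).
pose G := second_order_jet a_tilde N.
pose J h z := series_upto N (m := fun=> M) I h (fun j => G j h z).
have sI := jet_smooth_series Q_open (N := N) f1 (fun i _ => I_smooth i).
have sJ : jet_smooth Q 1 J.
  apply: (jet_smooth_comp Q_open f1 sI) => // j _.
  exact: jet_smooth_second_order_jet.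
have [F sF FE] := sJ.
(* [J] depends on h through the arguments of [I] as well, and so need not be a polynomial in h; its
   Taylor coefficients at 0 supply a series. The representative [F] turns them into functions of a
   matrix. *)
pose Ibar i (p : 'M[R]_(2, n)) := (i`!%:R)^-1 * iter i (@dh R _ R) F (0, p).
have IbarE i z : Q (z 0%N) ->
    Ibar i (trunc 1 z) = (i`!%:R)^-1 * derive1n i (fun h => J h z) 0.
  by move=> Qz; rewrite (derive1n_jet i FE Qz).
have Ibar_I e al be (g : R -> R -> 'rV[R]_n) : curve_family Q e al be g ->
    solves N (m := fun=> 1%N) a_tilde al be g ->
    forall x, family_dom e al be (0, x) -> Oloc N.+1 x (fun p : R * R =>
      series_upto N (m := fun=> 1%N) Ibar p.1 (prolong (g p.1) p.2)
      - series_upto N (m := fun=> M) I p.1 (prolong (g p.1) p.2)).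
  move=> [e0 sg gQ] /Oh_nextP gs x Dx.
  have oD := @open_family_dom R e al be.
  have jz := jet_family_prolong oD sg gQ.
  have gs' y : family_dom e al be (0, y) -> Oloc N.+1 y (fun p : R * R =>
      prolong (g p.1) p.2 2%N - series_upto N (m := fun=> 1%N) a_tilde p.1 (prolong (g p.1) p.2)).
    by move=> [_ yI]; exact: gs.
  (* [Ibar] differs from [J] by a Taylor remainder, and [J] from [I] by the error of expressing the
     prolongation through its 1-jet. *)
  apply: (Oloc_trans (v := fun p => J p.1 (prolong (g p.1) p.2))).
    apply: Oloc_ext (Oloc_subC (jet_taylor_Oloc Q_open oD N.+1 f1 sJ jz Dx)).
    apply: filterS (open_nbhs_nbhs (conj oD Dx)) => p Dp; congr (_ - _).
    by apply: eq_bigr => i _; rewrite IbarE//; exact: gQ.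
  have jG := jet_family_second_order_jet Q_open b_smooth oD sg gQ.
  apply: (jet_smooth_Oloc Q_open oD f1 sI jG jz Dx) => j _; apply: Oloc_subC.
  exact: (second_order_jet_Oloc Q_open b_smooth oD sg gQ gs').
have Ibar_smooth i : smooth_on (jet_space 1 Q) (Ibar i).
  have [F' sF' FE'] := jet_smooth_derive1n Q_open i f1 sJ.
  apply: (@smooth_on_jet_coef _ _ _ _ 1 1
    (fun z => (i`!%:R)^-1 *: derive1n i (fun h => J h z) 0)) => //.
    exists (fun p => (i`!%:R)^-1 *: F' p); last by move=> h z Qz; rewrite -(FE' h).
    by apply: smoothZ => //; [exact: open_jet_dom|exact: smooth_cst].
  by move=> z Qz; rewrite IbarE.
exists Ibar; split; first exact: Ibar_smooth.
- move=> e al be g cg gs.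
  have [e0 sg gQ] := cg; have oD := @open_family_dom R e al be.
  have jz := jet_family_prolong oD sg gQ.
  have gs' y : family_dom e al be (0, y) -> Oloc N.+1 y (fun p : R * R =>
      prolong (g p.1) p.2 2%N - series_upto N (m := fun=> 1%N) a_tilde p.1 (prolong (g p.1) p.2)).
    by move=> [_ yI]; move/Oh_nextP: gs; exact.
  have gT : solves N a al be g.
    apply/Oh_nextP => x xI.
    have Dx : family_dom e al be (0, x) by split; rewrite /= ?normr0.
    exact: (solves_of_reduced Q_open a_smooth oD m0 sg gQ a_tildeE gs' (leqnn _) Dx).
  have /Oh_nextP IT := I_conserved e al be g cg gT.
  apply/Oh_nextP => x xI.
  have Dx : family_dom e al be (0, x) by split; rewrite /= ?normr0.
  have sIbar : smooth_on (family_dom e al be)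
      (fun p : R * R => series_upto N (m := fun=> 1%N) Ibar p.1 (prolong (g p.1) p.2)).
    by apply: smooth_jet_family (jet_smooth_series Q_open f1 (fun i _ => Ibar_smooth i)) jz.
  have sIz := smooth_jet_family Q_open oD f1 sI jz.
  (* The comparison of [Ibar] with [I] holds at every x of the interval, as its differentiation
     requires. *)
  have OE := Oloc_dx oD f1 (smoothB oD sIbar sIz) (Ibar_I e al be g cg gs) Dx.
  apply: Oloc_ext (OlocD OE (IT x xI)).
  apply: filterS (open_nbhs_nbhs (conj oD Dx)) => -[h y] Dp.
  rewrite (derive1_dx (fun p : R * R => series_upto N I p.1 (prolong (g p.1) p.2))).
  rewrite (derive1_dx (fun p : R * R => series_upto N Ibar p.1 (prolong (g p.1) p.2))).
  by rewrite (dxB (smooth_differentiable sIbar Dp) (smooth_differentiable sIz Dp)) subrK.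
- move=> e al be g cg gs; apply/Oh_nextP => x xI; apply: (Ibar_I e al be g cg gs).
  have [e0 _ _] := cg.
  by split; rewrite /= ?normr0.
Qed.
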